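(* Let $d$ and $n$ be positive integers. The lattice $L_n^d$ inherits all properties of the $(P,\phi)$-Tamari lattices. In particular, it is a join-semidistributive lattice, and it is semidistributive if and only if $n\leq 2$ or $d=1$. The spine of $L_n^d$ corresponds to $J\big((os_n^{d+1})^{op}\big)$. We have $$\ell(L_n^d)=|\mathrm{JIrr}(L_n^d)|=\binom{n+d}{d+1}$$ and $$|\mathrm{MIrr}(L_n^d)|=(d-1)\,\binom{n+d}{d+2}+\frac{n(n+1)}{2}.$$
   Context: For positive integers $n,d$, $os_n^{d}$ is the set of non-decreasing sequences $x=(x_1,\dots,x_d)$ of elements of $\{0,1,\dots,n-1\}$, ordered by the product (componentwise) order $\leq$; $os_n^{d+1}$ is defined in the same way with sequences of length $d+1$. $L_n^d$ is the lattice, ordered by inclusion, of the $d$-torsion classes of the $(d-1)$-Auslander algebra of type $\mathbf{A}_n$ (that is, of the unique $d$-cluster tilting subcategory of its module category). By a theorem of August et al., these are identified with the subsets $T\subseteq os_n^{d+1}$ satisfying the following two conditions, which may be taken as the definition of the elements of $L_n^d$: (1) for all $0\le i<n$, $\{x\in T\mid x_{d+1}=i\}$ is an order filter (up-closed subset) of the poset $\{x\in os_n^{d+1}\mid x_{d+1}=i\}$ with the product order; (2) for all $x,z\in T$ such that $x_1\le z_1-1\le x_2\le z_2-1\le\cdots\le x_{d+1}\le z_{d+1}-1$, every $y\in os_n^{d+1}$ with $y_i\in\{x_i,z_i\}$ for each $i$ belongs to $T$. The meet in $L_n^d$ is given by intersection. $(P,\phi)$-Tamari lattices: let $P$ be a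 poset whose principal order ideals are all finite and let $\phi:\phi(0)<\phi(1)<\cdots<\phi(n-1)$ be a finite chain in $P$. For $0\le i<n$ let $\mathcal{C}_i=\{x\in P\mid x\leq\phi(i)\}\times\{i\}$, ordered as a subposet of $P$ in the first coordinate, and let $\mathcal{C}_P^{\phi}$ be the disjoint union of the posets $\mathcal{C}_0,\dots,\mathcal{C}_{n-1}$ (elements of different components are incomparable). An order filter $T$ of $\mathcal{C}_P^{\phi}$ is torclosed if for all $i<j$, having both $(x,i)\in T$ and $(\phi(i+1),j)\in T$ implies $(x,j)\in T$. The $(P,\phi)$-Tamari lattice $\mathrm{Tam}(P,\phi)$ is the set of torclosed sets ordered by inclusion; it is a lattice with meet given by intersection. The lattice $L_n^d$ is a $(P,\phi)$-Tamari lattice: $L_n^d=\mathrm{Tam}\big((os_n^d,\leq),\phi\big)$ with $\phi(i)=(i,\dots,i)$ for all $0\le i<n$, where $((x_1,\dots,x_d),i)$ is identified with $(x_1,\dots,x_d,i)\in os_n^{d+1}$. For a finite lattice $L$: $\mathrm{JIrr}(L)$ (resp. $\mathrm{MIrr}(L)$) is the set of elements covering exactly one element (resp. covered by exactly one element); the length of a chain $x_0<\cdots<x_k$ is $k$, and $\ell(L)$ is the maximum length of a chain in $L$; the spine of $L$ is the set of elements lying on some chain of length $\ell(L)$; $L$ is join-semidistributive if for all $x,y,z\in L$, $x\vee y=x\vee z$ implies $x\vee(y\wedge z)=x\vee y$; meet-semidistributive is defined dually, and semidistributive means both. For a poset $Q$, $J(Q)$ is the poset of order ideals (down-closed subsets)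 of $Q$ ordered by inclusion, and $Q^{op}$ is the dual poset. *)

(* Defs.v *)
From HB Require Import structures.
From mathcomp Require Import all_boot all_order.

Set Implicit Arguments.
Unset Strict Implicit.
Unset Printing Implicit Defensive.

Import Order.TTheory Order.DefaultSetSubsetOrder.

Local Open Scope order_scope.

Section FinPOrder.
Context {disp : Order.disp_t} {T : finPOrderType disp}.
Implicit Types x y : T.

Definition covers x y := (y < x) && [forall z : T, ~~ ((y < z) && (z < x))].

Definition is_chain k (c : k.+1.-tuple T) := sorted <%O c.

End FinPOrder.

Section FinPOrderSets.
Context {disp : Order.disp_t} (T : finPOrderType disp).

Definition JIrr : {set T} := [set x | #|[set y | covers x y]| == 1%N].

Definition MIrr : {set T} := [set x | #|[set y | covers y x]| == 1%N].

(* A chain with [k.+1] elements has length [k]; since it has at most [#|T|]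
   elements, the bound [k < #|T|] loses no chain. *)
Definition lattice_length : nat :=
  (\max_(k < #|T| | [exists c : k.+1.-tuple T, is_chain c]) k)%N.

Definition spine : {set T} :=
  [set x | [exists c : lattice_length.+1.-tuple T, is_chain c && (x \in c)]].

Definition J : {set {set T}} :=
  [set I : {set T} | [forall x in I, forall y : T, (y <= x) ==> (y \in I)]].

End FinPOrderSets.

Section Semidistributivity.
Context {disp : Order.disp_t} (T : latticeType disp).

Definition join_semidistributive :=
  forall x y z : T, x `|` y = x `|` z -> x `|` (y `&` z) = x `|` y.

Definition meet_semidistributive :=
  forall x y z : T, x `&` y = x `&` z -> x `&` (y `|` z) = x `&` y.

Definition semidistributive := join_semidistributive /\ meet_semidistributive.

End Semidistributivity.

Section Tamari.
Context {disp : Order.disp_t} {P : porderType disp} {n : nat}.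
Variable phi : 'I_n -> P.

(* The order of C = C_0 + ... + C_{n-1} only compares pairs with the same
   second component. *)
Definition filterC (U : {pred P * 'I_n}) :=
  (forall x i, (x, i) \in U -> x <= phi i) /\
  (forall x y i, (x, i) \in U -> x <= y -> y <= phi i -> (y, i) \in U).

(* [i1] is [i + 1], which is a valid index because [i < j < n]. *)
Definition torclosed (U : {pred P * 'I_n}) :=
  filterC U /\
  (forall (x : P) (i i1 j : 'I_n), (i < j)%N -> i1 = i.+1 :> nat ->
     (x, i) \in U -> (phi i1, j) \in U -> (x, j) \in U).

(* [P] and [phi] are as required in the definition of Tam(P, phi), and [f] is
   an isomorphism from [L] onto the poset Tam(P, phi) of torclosed sets ordered
   by inclusion (a set being a boolean predicate up to extensionality). *)
Definition Tam_iso {dispL : Order.disp_t} {L : porderType dispL}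
    (f : L -> {pred P * 'I_n}) :=
  [/\ forall x : P, exists s : seq P, forall y, y <= x -> y \in s,
      forall i j : 'I_n, (i < j)%N -> phi i < phi j,
      forall T, torclosed (f T),
      forall T1 T2, T1 <= T2 <-> {subset f T1 <= f T2}
    & forall U, torclosed U -> exists T, f T =i U].

End Tamari.

Definition nondecr n d (x : d.-tuple 'I_n) :=
  [forall i : 'I_d, forall j : 'I_d, (i <= j)%N ==> (tnth x i <= tnth x j)%N].

(* os_n^d, with the componentwise order (see [leEos]). *)
Record os (n d : nat) := Os {
  os_val : d.-tupleprod 'I_n;
  os_valP : nondecr os_val
}.

Fact os_display : Order.disp_t. Proof. exact: (Order.Disp tt tt). Qed.

HB.instance Definition _ n d := [isSub for @os_val n d].
HB.instance Definition _ n d := [Finite of os n d by <:].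
HB.instance Definition _ n d :=
  [SubChoice_isSubPOrder of os n d by <: with os_display].

(* Coordinates are numbered from 0: [coord x i] is x_{i+1}. *)
Definition coord n d (x : os n d) (i : 'I_d) : 'I_n := tnth (os_val x) i.

Lemma leEos n d (x y : os n d) :
  (x <= y) = [forall i, (coord x i <= coord y i)%N].
Proof. exact: leEtprod. Qed.

Definition os_last n d (x : os n d.+1) : 'I_n := coord x ord_max.

Fact os_init_subproof n d (x : os n d.+1) :
  nondecr [tuple coord x (widen_ord (leqnSn d) i) | i < d].
Proof.
apply/forallP => i; apply/forallP => j; apply/implyP => ij.
rewrite !tnth_mktuple.
by have /forallP/(_ _)/forallP/(_ _)/implyP := os_valP x; apply.
Qed.

Definition os_init n d (x : os n d.+1) : os n d := Os (os_init_subproof x).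

(* The identification of (x_1, ..., x_d, i) with ((x_1, ..., x_d), i). *)
Definition os_split n d (x : os n d.+1) : os n d * 'I_n :=
  (os_init x, os_last x).

Fact os_diag_subproof n d (i : 'I_n) : nondecr [tuple i | _ < d].
Proof.
by apply/forallP => j; apply/forallP => k; apply/implyP; rewrite !tnth_mktuple.
Qed.

Definition os_diag n d (i : 'I_n) : os n d := Os (os_diag_subproof d i).

(* x_1 <= z_1 - 1 <= x_2 <= z_2 - 1 <= ... <= x_{m} <= z_{m} - 1. The
   inequality x_i <= z_i - 1 is over the integers, hence written x_i < z_i;
   it makes the truncated subtraction in the other one exact. *)
Definition interlaced n m (x z : os n m) :=
  [forall i, (coord x i < coord z i)%N] &&
  [forall i : 'I_m, forall j : 'I_m, (j == i.+1 :> nat) ==> (coord z i - 1 <= coord x j)%N].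

(* Combinatorial description (August et al.) of the d-torsion classes of the
   (d-1)-Auslander algebra of type A_n. *)
Section dTorsion.
Variables n d : nat.
Implicit Types T : {set os n d.+1}.

Definition slice_filters T :=
  [forall x in T, forall y,
     [&& os_last y == os_last x & x <= y] ==> (y \in T)].

Definition mixing_closed T :=
  [forall x in T, forall z in T, forall y,
     interlaced x z && [forall i, coord y i \in [:: coord x i; coord z i]]
     ==> (y \in T)].

Definition is_dtorsion T := slice_filters T && mixing_closed T.

End dTorsion.

(* L_n^d, ordered by inclusion. *)
Record dtors (n d : nat) := DTors {
  dtors_val : {set os n d.+1};
  dtors_valP : is_dtorsion dtors_val
}.

Fact dtors_display : Order.disp_t. Proof. exact: (Order.Disp tt tt). Qed.

HB.instance Definition _ n d := [isSub for @dtors_val n d].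
HB.instance Definition _ n d := [Finite of dtors n d by <:].
HB.instance Definition _ n d :=
  [SubChoice_isSubPOrder of dtors n d by <: with dtors_display].

Lemma leEdtors n d (T1 T2 : dtors n d) :
  (T1 <= T2) = (dtors_val T1 \subset dtors_val T2).
Proof. by []. Qed.

Lemma is_dtorsionI n d (T1 T2 : {set os n d.+1}) :
  is_dtorsion T1 -> is_dtorsion T2 -> is_dtorsion (T1 :&: T2).
Proof.
move=> /andP[F1 M1] /andP[F2 M2]; apply/andP; split.
  apply/'forall_implyP => x /setIP[x1 x2]; apply/forallP => y; apply/implyP => xy.
  rewrite inE (implyP (forallP (implyP (forallP F1 x) x1) y) xy).
  exact: (implyP (forallP (implyP (forallP F2 x) x2) y) xy).
apply/'forall_implyP => x /setIP[x1 x2]; apply/'forall_implyP => z /setIP[z1 z2].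
apply/forallP => y; apply/implyP => xyz.
rewrite inE.
rewrite (implyP (forallP (implyP (forallP (implyP (forallP M1 x) x1) z) z1) y)
  xyz).
exact: (implyP (forallP (implyP (forallP (implyP (forallP M2 x) x2) z) z2) y)
  xyz).
Qed.

Lemma is_dtorsionT n d : is_dtorsion [set: os n d.+1].
Proof.
apply/andP; split; apply/'forall_implyP => x _.
  by apply/forallP => y; rewrite inE implybT.
by apply/'forall_implyP => z _; apply/forallP => y; rewrite inE implybT.
Qed.

Section dTorsionLattice.
Variables n d : nat.
Implicit Types T : dtors n d.

Definition dtors_meet T1 T2 : dtors n d :=
  DTors (is_dtorsionI (dtors_valP T1) (dtors_valP T2)).

Fact dtors_join_subproof T1 T2 :
  is_dtorsion (\bigcap_(T : dtors n d | (T1 <= T) && (T2 <= T)) dtors_val T).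
Proof.
apply: (big_ind (@is_dtorsion n d)) => [||T _]; last exact: dtors_valP.
  exact: is_dtorsionT.
exact: is_dtorsionI.
Qed.

Definition dtors_join T1 T2 : dtors n d := DTors (dtors_join_subproof T1 T2).

Fact dtors_meetP T T1 T2 : (T <= dtors_meet T1 T2) = (T <= T1) && (T <= T2).
Proof. by rewrite !leEdtors subsetI. Qed.

Fact dtors_joinP T1 T2 T : (dtors_join T1 T2 <= T) = (T1 <= T) && (T2 <= T).
Proof.
apply/idP/andP => [le_T | [T1T T2T]].
  by split; apply: le_trans le_T; rewrite leEdtors; apply/bigcapsP => U /andP[].
by rewrite leEdtors; apply: bigcap_inf; rewrite T1T.
Qed.

HB.instance Definition _ := Order.POrder_MeetJoin_isLattice.Build
  dtors_display (dtors n d) dtors_meetP dtors_joinP.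

End dTorsionLattice.

(* Main.v *)
(* The isomorphism with Tam(P, phi) reduces everything but the counts to
   arguments about torclosed sets.

   If [U] is covered by [V], then [V \ U] lies in one component C_j and has a
   greatest element [p]: any torclosed set contained in [V] but not in [U]
   contains [p], which gives join-semidistributivity. Order filters of a single
   component are torclosed, so the join-irreducibles are the principal ones, and
   there are as many as elements of C. Sets which are moreover closed under
   (x, i) -> (x, j) for i <= j can be built up one element at a time, so the
   length is |C|; conversely, in a chain of length |C|, if (x, i) is added before
   (x, j), then (x, j) and (phi(i+1), j) have to be added simultaneously, which is
   impossible since each step adds a single element.

   When phi(0) is the bottom, the meet-irreducibles are the sets
   {(y, k) | k > j, or k < a, or y is below neither x nor phi(a)}, with x <= phi(j),
   a <= j, x not above phi(a+1), and x not below phi(a) unless x = phi(a). In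
   os_n^d, the triples with x <> phi(a) are those with x_1 <= a < x_d <= j: they
   number the sum of x_d - x_1 over os_n^{d+1}, on which x_k sums to
   k 'C(n + d, d + 2) by Pascal's rule. *)
Require Import Defs.
From mathcomp Require Import all_boot all_order.

Set Implicit Arguments.
Unset Strict Implicit.
Unset Printing Implicit Defensive.

Import Order.TTheory.

Local Open Scope order_scope.

(** * Covers and irreducible elements in finite posets *)

Section FinPOrderFacts.
Context {disp : Order.disp_t} {T : finPOrderType disp}.
Implicit Types (x y z : T) (A : {pred T}).

Lemma ex_maximal A x : x \in A ->
  exists m, [/\ m \in A, x <= m & forall y, y \in A -> m <= y -> y = m].
Proof.
move=> xA; have xP : (x \in A) && (x <= x) by rewrite xA lexx.
(* An element with the fewest members of [A] above it is maximal. *)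
case: (@arg_minnP _ x (fun m => (m \in A) && (x <= m))
         (fun m => #|[set y in A | m <= y]|) xP) => m /andP[mA xm] mmin.
exists m; split=> // y yA my; apply/eqP/negPn/negP => ym.
have := mmin y; rewrite yA (le_trans xm my) => /(_ isT); apply/negP; rewrite -ltnNge.
apply/proper_card/properP; split.
  by apply/subsetP => z; rewrite !inE => /andP[-> /(le_trans my)].
exists m; rewrite !inE ?mA ?lexx //=; apply: contra ym => ym.
by rewrite eq_le ym.
Qed.

Lemma ex_lower_cover x y : x < y -> exists2 z, covers y z & x <= z.
Proof.
move=> xy; have [|z [/andP[xz zy] _ zmax]] :=
  @ex_maximal [pred z | x <= z < y] x; first by rewrite inE lexx.
exists z => //; rewrite /covers zy; apply/forallP => t; apply/negP => /andP[zt ty].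
by move: (zt); rewrite (zmax t) ?ltxx ?(ltW zt) // inE ty (le_trans xz (ltW zt)).
Qed.

(** By finiteness, each element strictly below [x] lies below a lower cover of [x]; so a unique
    lower cover is the greatest element strictly below [x]. *)
Lemma JIrrP x :
  reflect (exists2 y, y < x & forall z, z < x -> z <= y) (x \in JIrr T).
Proof.
rewrite inE; apply: (iffP cards1P) => [[y yE] | [y yx ymax]].
  have: y \in [set y] by rewrite inE.
  rewrite -yE inE => /andP[yx _]; exists y => // u /ex_lower_cover[t xt ut].
  by have: t \in [set y]; [rewrite -yE inE | rewrite inE => /eqP <-].
exists y; apply/setP => z; rewrite !inE; apply/idP/eqP => [/andP[zx /forallP nz]|->].
  apply/eqP; rewrite eq_le ymax //=; move/(_ y): nz; rewrite yx andbT => nz.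
  by apply/negPn/negP => yz; case/negP: nz; rewrite lt_neqAle ymax // andbT;
     apply: contra yz => /eqP ->.
rewrite /covers yx; apply/forallP => t; apply/negP => /andP[yt /ymax ty].
by move: (lt_le_trans yt ty); rewrite ltxx.
Qed.

End FinPOrderFacts.

Section Dual.
Context {disp : Order.disp_t} {T : finPOrderType disp}.

Lemma MIrr_dual : MIrr T = JIrr T^d.
Proof.
apply/setP => x; rewrite !inE; congr (#|pred_of_set _| == _); apply/setP => y.
by rewrite !inE /covers; congr andb; apply: eq_forallb => z; rewrite andbC.
Qed.

Lemma MIrrP (x : T) :
  reflect (exists2 y, x < y & forall z, x < z -> y <= z) (x \in MIrr T).
Proof. rewrite MIrr_dual; exact: (@JIrrP _ T^d). Qed.

End Dual.

(** * Tamari lattices *)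

Section Tamari.
Context {disp : Order.disp_t} {P : finPOrderType disp} {n : nat}.
Variable phi : 'I_n -> P.
Context {dispL : Order.disp_t} {L : finLatticeType dispL}.
Variable f : L -> {pred P * 'I_n}.
Hypothesis f_iso : Tam_iso phi f.
Implicit Types (x y z : P) (i j k : 'I_n) (p q : P * 'I_n) (T : L).
Implicit Types U : {pred P * 'I_n}.

(** * Torclosed sets seen through the isomorphism *)

Let phi_lt i j : (i < j)%N -> phi i < phi j.
Proof. by case: f_iso => _ H _ _ _; apply: H. Qed.

Let phi_le i j : (i <= j)%N -> phi i <= phi j.
Proof. by rewrite leq_eqVlt => /predU1P[/val_inj -> | /phi_lt/ltW]. Qed.

Let f_le T1 T2 : reflect {subset f T1 <= f T2} (T1 <= T2).
Proof. by case: f_iso => _ _ _ H _; apply: (iffP idP); apply H. Qed.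

Let f_bound T x i : (x, i) \in f T -> x <= phi i.
Proof. by case: f_iso => _ _ /(_ T)[[H _] _] _ _; apply: H. Qed.

Let f_up T x y i : (x, i) \in f T -> x <= y -> y <= phi i -> (y, i) \in f T.
Proof. by case: f_iso => _ _ /(_ T)[[_ H] _] _ _; apply: H. Qed.

Let f_tor T x i i1 j : (i < j)%N -> i1 = i.+1 :> nat ->
  (x, i) \in f T -> (phi i1, j) \in f T -> (x, j) \in f T.
Proof. by case: f_iso => _ _ /(_ T)[_ H] _ _; apply: H. Qed.

Let f_onto U : torclosed phi U -> exists T, f T =i U.
Proof. by case: f_iso => _ _ _ _; apply. Qed.

Let f_eq T1 T2 : f T1 =i f T2 -> T1 = T2.
Proof.
by move=> E; apply: le_anti; apply/andP; split; apply/f_le => p; rewrite E.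
Qed.

Let f_lt T1 T2 :
  T1 < T2 -> exists p, [/\ p \in f T2, p \notin f T1 & T1 <= T2].
Proof.
rewrite lt_leAnge => /andP[T12 nT].
case: (pickP [pred p | (p \in f T2) && (p \notin f T1)]) => [p /andP[]|nop].
  by exists p.
case/f_le: nT => p pT2; apply/negPn/negP => pT1.
by have /andP[] := nop p.
Qed.

Let f_nle T1 T2 p : p \in f T1 -> p \notin f T2 -> ~~ (T1 <= T2).
Proof. by move=> p1; apply: contra => /f_le; apply. Qed.

(** Torclosed sets are stable under intersection, so the intersection is some [f W], and [W] is then
    the meet because [f] is an order isomorphism. *)
Let f_meet T1 T2 p : (p \in f (T1 `&` T2)) = (p \in f T1) && (p \in f T2).
Proof.
have [|W WE] := @f_onto [pred p | (p \in f T1) && (p \in f T2)].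
  split; first split.
  - by move=> x i /andP[/f_bound].
  - by move=> x y i /andP[x1 x2] xy yi; rewrite inE (f_up x1) ?(f_up x2).
  move=> x i i1 j ij i1E /andP[x1 x2] /andP[p1 p2].
  by rewrite inE (f_tor ij i1E x1) // (f_tor ij i1E x2).
suff -> : T1 `&` T2 = W by rewrite WE inE.
apply: le_anti; apply/andP; split.
  have /f_le le1 := leIl T1 T2; have /f_le le2 := leIr T2 T1.
  by apply/f_le => q q12; rewrite WE inE le1 ?le2.
by rewrite lexI; apply/andP; split; apply/f_le => q; rewrite WE => /andP[].
Qed.

(** The principal order filter of [p] in its own component. *)
Let slice_gt p : {pred P * 'I_n} :=
  [pred q | [&& q.2 == p.2, p.1 <= q.1 & q.1 <= phi q.2]].

(** The closure condition is vacuous here, as its premises concern two distinct components. *)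
Let slice_tor p : torclosed phi (slice_gt p).
Proof.
split; first split.
- by move=> x i /and3P[].
- by move=> x y i /and3P[/= pi px _] xy yi; rewrite inE /= pi yi (le_trans px).
move=> x i i1 j ij i1E /and3P[/= /eqP ip _ _] /and3P[/= /eqP jp _ _].
by rewrite ip jp ltnn in ij.
Qed.

(** * Covers and semidistributivity *)

Lemma Tam_cover T1 T2 : covers T2 T1 ->
  exists2 p, (p \in f T2) && (p \notin f T1) &
    forall q, q \in f T2 -> q \notin f T1 -> q.2 = p.2 /\ q.1 <= p.1.
Proof.
case/andP=> T12 /forallP nbetw.
(* The form in which covering is used: a torclosed set between [f T1] and [f T2] that gains an
   element contains all of [f T2]. *)
have cov U p : torclosed phi U -> {subset f T1 <= U} -> {subset U <= f T2} ->
    p \in U -> p \notin f T1 -> {subset f T2 <= U}.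
  move=> /f_onto[T TE] T1U UT2 pU pT1; suff <- : T = T2 by move=> q; rewrite TE.
  have T2le : T <= T2 by apply/f_le => q; rewrite TE; apply: UT2.
  apply/eqP; move: (nbetw T); rewrite negb_and !lt_neqAle T2le andbT negbK.
  have -> : T1 <= T by apply/f_le => q; rewrite TE; apply: T1U.
  rewrite andbT negbK => /orP[/eqP TT|//].
  by rewrite TT TE pU in pT1.
pose D := [pred p | (p \in f T2) && (p \notin f T1)].
have [p0 [p02 p01 /f_le sub12]] := f_lt T12.
have [pm [mD mmax]] : exists p, p \in D /\ forall q, q \in D -> (q.2 <= p.2)%N.
  have p0D : p0 \in D by rewrite inE p02.
  case: (@arg_maxnP _ p0 (mem D) (fun p => val p.2) p0D) => p pD pmax.
  by exists p.
(* Adding to [f T1] the part of [f T2] in the last component met by [D] gives a torclosed set: a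
   violation would put an element of [D] in a later component. *)
have mE q : q \in D -> q.2 = pm.2.
  case/andP=> q2 q1.
  have /andP[m2 m1] := mD.
  have /(_ _ _ _ _ m1 q q2)/orP[] :=
    cov [pred p | (p \in f T1) || ((p \in f T2) && (p.2 == pm.2))] pm.
  - split; first split.
    + by move=> x i /orP[/f_bound|/andP[/f_bound]].
    + move=> x y i /orP[xi|/andP[xi /= im]] xy yi; rewrite inE /=.
        by rewrite (f_up xi).
      by rewrite (f_up xi) // im orbT.
    move=> x i i1 j ij i1E xi pj; rewrite inE /=.
    have xj2 : (x, j) \in f T2.
      apply: (f_tor ij i1E).
        by case/orP: xi => [/sub12 //|/andP[]].
      by case/orP: pj => [/sub12 //|/andP[]].
    rewrite xj2 /=; case: (boolP ((x, j) \in f T1)) => //= xj1.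
    case/orP: pj => [pj|/andP[] //]; case/orP: xi => [xi|/andP[_ /= /eqP im]].
      by rewrite (f_tor ij i1E xi pj) in xj1.
    have := mmax (x, j); rewrite inE xj2 xj1 -im => /(_ isT) /=.
    by rewrite leqNgt ij.
  - by move=> p p1; rewrite inE p1.
  - by move=> p /orP[/sub12 //|/andP[]].
  - by rewrite inE m2 eqxx orbT.
  - by rewrite (negPf q1).
  by case/andP=> _ /eqP.
(* Adding to [T1] a maximal element of the difference keeps it torclosed,
   unless that element is some [phi i.+1]. *)
have max_phi x : (x, pm.2) \in D ->
    (forall y, (y, pm.2) \in D -> x <= y -> y = x) ->
    (forall y, (y, pm.2) \in D -> y <= x) \/ exists i, x = phi i.
  move=> /andP[x2 x1] xmax; case: (pickP (fun i => x == phi i)) => [i /eqP ->|nphi].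
    by right; exists i.
  left=> y /andP[y2 y1]; suff /orP[|/eqP[->]//] :
    (y, pm.2) \in [pred p | (p \in f T1) || (p == (x, pm.2))] by rewrite (negPf y1).
  apply: (cov _ (x, pm.2)) => //; last by rewrite inE eqxx orbT.
  - split; first split.
    + by move=> z i /orP[/f_bound|/eqP[-> ->]] //; apply: f_bound x2.
    + move=> z t i /orP[zi|/eqP[-> ->]] zt ti; rewrite inE.
        by rewrite (f_up zi).
      case: (boolP ((t, pm.2) \in f T1)) => //= t1; rewrite (xmax t) ?eqxx //.
      by rewrite inE t1 (f_up x2).
    move=> z i i1 j ij i1E zi /orP[pj|/eqP[pE]]; last first.
      by have := nphi i1; rewrite pE eqxx.
    rewrite inE; case/orP: zi => [zi|/eqP[zE iE]]; first by rewrite (f_tor ij i1E zi).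
    case: (boolP ((z, j) \in f T1)) => //= zj.
    have jD : (z, j) \in D.
      by rewrite inE zj (f_tor ij i1E _ (sub12 _ pj)) // zE iE.
    by have := mmax _ jD; rewrite -iE leqNgt ij.
  - by move=> p p1; rewrite inE p1.
  by move=> p /orP[/sub12 //|/eqP ->].
have [|x [xD _ xmax]] := @ex_maximal _ _ [pred x | (x, pm.2) \in D] pm.1.
  by rewrite inE -surjective_pairing.
exists (x, pm.2) => //= q q2 q1; have qD : q \in D by rewrite inE q2.
split; first exact: mE.
have qx : (q.1, pm.2) \in D by rewrite -(mE q) // -surjective_pairing.
(* A maximal element that is not the greatest is some [phi i], and these form a chain; hence any two
   maximal elements coincide. *)
case: (max_phi x xD xmax) => [|[i xi]]; first exact.
have [y [yD qy ymax]] := @ex_maximal _ _ [pred x | (x, pm.2) \in D] q.1 qx.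
apply: le_trans qy _; case: (max_phi y yD ymax) => [ay|[j yj]].
  by rewrite (xmax y yD) ?ay.
case: (leqP i j) => ij; last by rewrite xi yj phi_le // ltnW.
by rewrite (xmax y yD) // xi yj phi_le.
Qed.

Lemma Tam_join_semidistributive : join_semidistributive L.
Proof.
move=> x y z xyz; apply: le_anti.
have -> /= : x `|` (y `&` z) <= x `|` y by rewrite leU2 // leIl.
apply/negPn/negP => nle.
(* A lower cover [T] of the join contains [x], so it contains neither [y] nor [z]. Both then contain
   the greatest element [p] missed by [T], although their meet is below [T]. *)
have /ex_lower_cover[T] : x `|` (y `&` z) < x `|` y.
  by rewrite lt_leAnge nle leU2 // leIl.
rewrite leUx => cT /andP[xT yzT].
have [p /andP[pT2 pT] pmax] := Tam_cover cT.
have mem_p u : u <= x `|` y -> ~~ (u <= T) -> p \in f u.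
  move=> /f_le uxy nuT.
  have [q /andP[qu qT]] : exists q, (q \in f u) && (q \notin f T).
    case: (pickP [pred q | (q \in f u) && (q \notin f T)]) => [q|nq]; first by exists q.
    case/f_le: nuT => q qu; apply/negPn/negP => qT; have := nq q.
    by rewrite inE /= qu qT.
  have [qE qp] := pmax q (uxy _ qu) qT.
  case: p q qE qp qu qT pT2 {pT pmax} => [p i] [q j] /= -> qp qu _ pT2.
  exact: f_up qu qp (f_bound pT2).
have py : p \in f y by apply: mem_p (leUr _ _) _; apply: contraTN cT => yT;
  rewrite /covers lt_leAnge leUx xT yT andbF.
have pz : p \in f z by apply: mem_p; [by rewrite xyz leUr|];
  apply: contraTN cT => zT; rewrite /covers lt_leAnge xyz leUx xT zT andbF.
by case/negP: pT; move/f_le: yzT; apply; rewrite f_meet py.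
Qed.

(** The set [M] below gives the greatest [T] having the same meet with [X] as [Y] has; it is above
    [Y] and [Z], hence above their join. Comparability with the [phi i] makes [M] torclosed. *)
Lemma Tam_meet_semidistributive :
  (forall (i j : 'I_n) y, (0 < i <= j)%N -> y <= phi j -> y >=< phi i) ->
  meet_semidistributive L.
Proof.
move=> phi_cmp X Y Z XYZ; apply: le_anti.
have -> : X `&` Y <= X `&` (Y `|` Z) by rewrite leI2 ?leUl.
rewrite andbT.
have XY p : p \in f X -> (p \in f Y) = (p \in f Z).
  by move=> pX; have := f_meet X Y p; rewrite XYZ f_meet pX.
(* The second clause makes torclosedness provable: it anticipates the use of
   [p] as the first premise of the closure condition. *)
pose M := [pred p : P * 'I_n | [&& p.1 <= phi p.2,
  [forall y, (p.1 <= y) && ((y, p.2) \in f X) ==> ((y, p.2) \in f Y)] &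
  [forall j1 : 'I_n, forall k : 'I_n, forall y,
    [&& (p.2 < k)%N, j1 == p.2.+1 :> nat, (phi j1, k) \in f X,
        (phi j1, k) \in f Y, p.1 <= y & (y, k) \in f X] ==> ((y, k) \in f Y)]]].
have MP x j : reflect
    [/\ x <= phi j, forall y, x <= y -> (y, j) \in f X -> (y, j) \in f Y &
     forall (j1 k : 'I_n) y, (j < k)%N -> j1 = j.+1 :> nat ->
       (phi j1, k) \in f X -> (phi j1, k) \in f Y -> x <= y -> (y, k) \in f X ->
       (y, k) \in f Y] ((x, j) \in M).
  apply: (iffP and3P) => -[/= xj A B]; split=> //.
  - by move=> y xy yX; move/forallP/(_ y): A; rewrite xy yX.
  - move=> j1 k y jk j1E jX jY xy yX; move/forallP/(_ j1)/forallP/(_ k)/forallP/(_ y): B.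
    by rewrite jk j1E eqxx jX jY xy yX.
  - by apply/forallP => y; apply/implyP => /andP[xy]; apply: A.
  apply/forallP => j1; apply/forallP => k; apply/forallP => y; apply/implyP.
  by case/and5P=> jk /eqP j1E jX jY /andP[xy]; apply: (B j1).
have [|T TE] := @f_onto M.
  split; first split.
  - by move=> x i /MP[].
  - move=> x y i /MP[xi A B] xy yi; apply/MP; split=> // [z yz|j1 k z jk j1E jX jY yz].
      exact: A (le_trans xy yz).
    exact: (B _ _ _ jk j1E jX jY (le_trans xy yz)).
  move=> x i i1 j ij i1E /MP[xi A B] /MP[i1j A' B']; apply/MP; split.
  - by apply: le_trans xi (phi_le (ltnW ij)).
  (* If [y] is below [phi i1], then [(phi i1, j)] is in [X], hence in [Y], and [B] applies; if [y]
     is above, [A'] applies. *)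
  - move=> y xy yX; have /orP[yi1|] : y >=< phi i1.
    + by apply: (phi_cmp _ j); rewrite ?i1E ?ij // (f_bound yX).
    + have i1X := f_up yX yi1 i1j.
      exact: (B _ _ _ ij i1E i1X (A' _ (lexx _) i1X) xy yX).
    by move=> i1y; apply: A'.
  move=> j1 k y jk j1E jX jY xy yX; have /orP[yi1|] : y >=< phi i1.
  + by apply: (phi_cmp _ k); rewrite ?i1E ?(ltn_trans ij jk) // (f_bound yX).
  + have i1X := f_up yX yi1 (le_trans i1j (phi_le (ltnW jk))).
    have i1Y := B' _ _ _ jk j1E jX jY (lexx _) i1X.
    exact: (B _ _ _ (ltn_trans ij jk) i1E i1X i1Y xy yX).
  by move=> i1y; apply: (B' j1).
have leT W : (forall p, p \in f X -> (p \in f Y) = (p \in f W)) -> W <= T.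
  move=> XW; apply/f_le => -[x j] xW; rewrite TE; apply/MP; split.
  - exact: f_bound xW.
  - by move=> y xy yX; rewrite XW // (f_up xW) // (f_bound yX).
  move=> j1 k y jk j1E jX jY xy yX; rewrite XW // (f_up _ xy) ?(f_bound yX) //.
  by apply: f_tor jk j1E xW _; rewrite -XW.
rewrite lexI leIl /=; apply/f_le => -[x j]; rewrite f_meet => /andP[xX].
have /f_le le : Y `|` Z <= T by rewrite leUx !leT.
by move=> /le; rewrite TE => /MP[_ A _]; apply: A.
Qed.

(** Take for [X] and [Z] the filters of [(y, j)] and [(phi i1, j)], and for [Y] the filter of
    [(x, i)] together with the intersection of [X] and [Z]. Both meets with [X] are this
    intersection, but the join of [Y] and [Z] contains [(x, j)] by closure, hence [(y, j)], which is
    in [X] but not in [Y]. *)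
Lemma Tam_not_meet_semidistributive (i i1 j : 'I_n) x y :
  (i < j)%N -> i1 = i.+1 :> nat -> x <= phi i -> x <= y -> y <= phi j ->
  ~~ (y >=< phi i1) -> ~ meet_semidistributive L.
Proof.
move=> ij i1E xi xy yj; rewrite negb_or => /andP[yi1 i1y] msd.
have [X XE] := f_onto (slice_tor (y, j)); have [Z ZE] := f_onto (slice_tor (phi i1, j)).
have [|Y YE] := @f_onto [pred q | (q \in slice_gt (x, i)) ||
    (q \in slice_gt (y, j)) && (q \in slice_gt (phi i1, j))].
  split; first split.
  - move=> z k /orP[|/andP[]] /and3P[] //.
  - move=> z t k; rewrite !inE /=.
    case/orP=> [/and3P[-> xz _] zt ->|/andP[/and3P[-> yz _] /and3P[_ i1z _]] zt ->].
      by rewrite (le_trans xz zt).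
    by rewrite (le_trans yz zt) (le_trans i1z zt) orbT.
  move=> z k k1 l kl k1E; rewrite !inE /=.
  case/orP=> [/and3P[/eqP kE xz zk]|/andP[/and3P[/eqP kE _ _] _]].
    have -> : k1 = i1 by apply: val_inj; rewrite /= k1E kE -i1E.
    case/orP=> [/and3P[/eqP lE]|/andP[/and3P[_]]]; first by rewrite kE lE ltnn in kl.
    by rewrite (negPf yi1).
  case/orP=> [/and3P[/eqP lE]|/andP[/and3P[/eqP lE]]].
    by rewrite kE lE ltnNge (ltnW ij) in kl.
  by rewrite kE lE ltnn in kl.
have /(msd X Y Z)/(congr1 f) : X `&` Y = X `&` Z.
  apply: f_eq => -[z k]; rewrite !f_meet XE YE ZE !inE /=.
  case: (k =P j) => //= ->; rewrite eq_sym (_ : (i == j) = false) //=.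
    by case: (y <= z); case: (z <= phi j); case: (phi i1 <= z).
  by apply/negP => /eqP ijE; rewrite ijE ltnn in ij.
move/(congr1 (fun U => (y, j) \in U)); rewrite !f_meet XE YE !inE /=.
rewrite eqxx lexx yj (negPf i1y) /= orbF.
have /f_le YYZ := leUl Y Z; have /f_le ZYZ := leUr Z Y.
have -> : (y, j) \in f (Y `|` Z).
  apply: (f_up _ xy yj); apply: (f_tor ij i1E).
    by apply: YYZ; rewrite YE !inE /= eqxx lexx xi.
  by apply: ZYZ; rewrite ZE !inE /= eqxx lexx phi_le // i1E.
by move/esym/and3P => [/eqP jE]; rewrite jE ltnn in ij.
Qed.

(** * Length and spine *)

Let C : {set P * 'I_n} := [set p | p.1 <= phi p.2].

Let rk T := #|f T|.

Let rk_lt T1 T2 : T1 < T2 -> (rk T1 < rk T2)%N.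
Proof.
move=> /f_lt[p [p2 p1 /f_le le12]]; apply/proper_card/properP; split.
  by apply/subsetP.
by exists p.
Qed.

Let f_sub_C T : f T \subset C.
Proof. by apply/subsetP => -[x i] /f_bound xi; rewrite inE. Qed.

Let rk_le T : (rk T <= #|C|)%N.
Proof. exact/subset_leq_card/f_sub_C. Qed.

(** Together with [filterC], this makes [U] an order filter of [C] for the product order, in which
    indices are compared too; such sets will form the spine. *)
Let up U := forall x i j, (i <= j)%N -> (x, i) \in U -> (x, j) \in U.

Let up_tor U : filterC phi U -> up U -> torclosed phi U.
Proof. by move=> FU upU; split=> // x i i1 j /ltnW ij _ xi _; apply: upU xi. Qed.

(** Each step adds a maximal missing element of the last component that is not full, which preserves
    both the filter condition and [up]. *)
Let chain_above T : up (f T) ->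
  exists s, path <%O T s /\ size s = (#|C| - rk T)%N.
Proof.
move: {2}(#|C| - rk T)%N (erefl (#|C| - rk T)%N) => m.
elim: m T => [|m IHm] T TE upT; first by exists [::].
have [p pD] : exists p, p \in [pred p | (p \in C) && (p \notin f T)].
  case: (pickP [pred p | (p \in C) && (p \notin f T)]) => [p pD|nD]; first by exists p.
  have : (#|C| <= rk T)%N.
    apply/subset_leq_card/subsetP => p pC; have := nD p.
    by rewrite inE /= pC => /negbFE.
  by rewrite -subn_eq0 TE.
have [[y j] yD jmax] := @arg_maxnP _ p (mem [pred p | (p \in C) && (p \notin f T)])
                         (fun p => val p.2) pD.
pose D := [pred x | ((x, j) \in C) && ((x, j) \notin f T)].
have [x [/andP[xC xT] _ xmax]] := @ex_maximal _ _ D y yD.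
pose U := [pred p | (p \in f T) || (p == (x, j))].
have upU : up U.
  move=> z k l kl /orP[zT|/eqP[-> kE]]; first by rewrite inE (upT _ _ _ kl).
  rewrite inE; case: (boolP ((x, l) \in f T)) => //= xlT.
  have xl : (x, l) \in C.
    by move: xC; rewrite !inE -kE /= => /le_trans; apply; apply: phi_le.
  have := jmax (x, l) (introT andP (conj xl xlT)); rewrite /= -kE => lk.
  by rewrite -(_ : k = l) //; apply/val_inj/anti_leq; rewrite kl.
have [|T' TE'] := @f_onto U.
  apply: up_tor upU.
    split=> [z k /orP[/f_bound //|/eqP[-> ->]]|z t k]; first by rewrite inE in xC.
    case/orP=> [zT zt tk|/eqP[-> ->] xt tj]; first by rewrite inE (f_up zT).
    rewrite inE; case: (boolP ((t, j) \in f T)) => //= tT.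
    by rewrite (xmax t) // !inE tj.
have rkT' : rk T' = (rk T).+1.
  have -> : rk T' = #|[set p in f T] :|: [set (x, j)]|.
    by rewrite /rk; apply: eq_card => q; rewrite TE' !inE.
  by rewrite setUC cardsU1 inE xT cardsE.
have [||s [sP sE]] := IHm T'; rewrite ?rkT' ?subnS ?TE //.
  by move=> z k l kl; rewrite !TE'; apply: upU.
exists (T' :: s); rewrite /= sP sE rkT' subnS TE; split=> //.
rewrite andbT lt_leAnge; apply/andP; split.
  by apply/f_le => q qT; rewrite TE' inE qT.
by apply: (f_nle (p := (x, j))) => //; rewrite TE' !inE eqxx orbT.
Qed.

(** Dually, each step removes a minimal element of the first nonempty component. *)
Let chain_below T : up (f T) ->
  exists s, sorted <%O (rcons s T) /\ size s = rk T.
Proof.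
move: {2}(rk T) (erefl (rk T)) => m.
elim: m T => [|m IHm] T TE upT; first by exists [::].
have [p pT] : exists p, p \in f T by apply/card_gt0P; rewrite -/(rk T) TE.
have [[y j] yT jmin] := @arg_minnP _ p (mem (f T)) (fun p => val p.2) pT.
have [x [xT _ xmin]] := @ex_maximal _ P^d [pred x | (x, j) \in f T] y yT.
have {}xT : (x, j) \in f T by [].
pose U := [pred p | (p \in f T) && (p != (x, j))].
have upU : up U.
  move=> z k l kl /andP[zT zx]; rewrite inE (upT _ _ _ kl) //=.
  apply: contra zx => /eqP[zE lE]; rewrite zE -lE.
  have := jmin _ zT; rewrite -lE => lk.
  by rewrite (_ : k = l) //; apply/val_inj/anti_leq; rewrite kl.
have [|T' TE'] := @f_onto U.
  apply: up_tor upU.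
    split=> [z k /andP[/f_bound //]|z t k /andP[zT zx] zt tk].
    rewrite inE (f_up zT) //=; apply: contra zx => /eqP[tE kE].
    by move: zT; rewrite kE => zT; rewrite (xmin z) // -tE.
have rkT : rk T = (rk T').+1.
  have -> : rk T' = #|[set p in f T] :\ (x, j)|.
    by rewrite /rk; apply: eq_card => q; rewrite TE' !inE andbC.
  by rewrite -[LHS]cardsE (cardsD1 (x, j)) inE xT.
have [||s [sP sE]] := IHm T'.
- by move: TE; rewrite rkT => -[].
- by move=> z k l kl; rewrite !TE'; apply: upU.
exists (rcons s T'); rewrite size_rcons sE rkT; split=> //.
have T'T : T' < T.
  rewrite lt_leAnge; apply/andP; split.
    by apply/f_le => q; rewrite TE' => /andP[].
  by apply: (f_nle (p := (x, j))) => //; rewrite TE' !inE eqxx andbF.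
case: s sP {sE} => [|a s] /=; first by rewrite T'T.
by rewrite [path _ _ (rcons (rcons _ _) _)]rcons_path last_rcons => ->.
Qed.

Let chain_through T : up (f T) ->
  exists s, [/\ sorted <%O s, size s = #|C|.+1 & T \in s].
Proof.
move=> upT; have [s1 [s1P s1E]] := chain_below upT.
have [s2 [s2P s2E]] := chain_above upT.
exists (s1 ++ T :: s2); split.
- case: s1 s1P {s1E} => //= a s; rewrite cat_path rcons_path /=.
  by case/andP=> -> ->.
- by rewrite size_cat /= s1E s2E addnS subnKC // rk_le.
by rewrite mem_cat mem_head orbT.
Qed.

Let chain_rk T s (a b : nat) : sorted <%O s -> (a <= b < size s)%N ->
  (rk (nth T s a) + (b - a) <= rk (nth T s b))%N.
Proof.
move=> /(sortedP T) sP /andP[/subnK <-]; rewrite addnK.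
elim: (b - a)%N => [|m IHm] ms; first by rewrite addn0.
by rewrite addnS addSn; apply: leq_ltn_trans (IHm (ltnW ms)) (rk_lt (sP _ ms)).
Qed.

Lemma Tam_length : lattice_length L = #|C|.
Proof.
apply/eqP; rewrite eqn_leq; apply/andP; split.
  (* The member [T] of the chain only serves as default value for [nth]. *)
  apply/bigmax_leqP => k /existsP[c cP]; have [T|c0] := pickP (mem c); last first.
    by have := c0 (tnth c ord0); rewrite inE mem_tnth.
  move=> _; have := @chain_rk T c 0 k cP; rewrite size_tuple ltnSn => /(_ isT).
  rewrite subn0 => /(leq_trans (leq_addl _ _)) /leq_trans; apply; exact: rk_le.
have [|T TE] := @f_onto (mem C).
  apply: up_tor; first by split=> [x i|x y i]; rewrite !inE.
  by move=> x i j /phi_le ij; rewrite !inE /= => /le_trans; apply.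
have [|s [sP sE _]] := @chain_through T.
  by move=> x i j /phi_le ij; rewrite !TE !inE /= => /le_trans; apply.
(* The members of the chain are distinct, so [#|C|] is within the range of the maximum defining
   [lattice_length]. *)
have sL : (#|C| < #|L|)%N.
  by rewrite -sE -(card_uniqP (lt_sorted_uniq sP)) max_card.
apply: (@leq_bigmax_cond _ _ _ (Ordinal sL)); apply/existsP.
by move/eqP: sE => sz; exists (Tuple sz).
Qed.

Lemma Tam_spine T : reflect (up (f T)) (T \in spine L).
Proof.
rewrite inE; apply: (iffP existsP) => [[c /andP[cP /(nthP T)[t]]]|upT]; last first.
  have [s [sP /eqP sE Ts]] := chain_through upT.
  by rewrite -Tam_length in sE; exists (Tuple sE); apply/andP.
have NC := Tam_length; have sz := size_tuple c.
move: (lattice_length L) NC c sz cP => N NC c sz cP.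
rewrite sz => tN tT x i j ij xi.
(* Ranks increase strictly along the chain and stay between 0 and [N], so the [k]-th member has rank
   exactly [k]. *)
have rkE (k : nat) : (k <= N)%N -> rk (nth T c k) = k.
  move=> kN; apply/eqP; rewrite eqn_leq.
  have := @chain_rk T c 0 k cP; rewrite sz ltnS kN => /(_ isT).
  rewrite subn0 => /(leq_trans (leq_addl _ _)) ->; rewrite andbT.
  have := @chain_rk T c k N cP; rewrite sz ltnS leqnn kN => /(_ isT).
  by move=> /leq_trans/(_ (rk_le _)); rewrite -NC => le;
    rewrite -(leq_add2r (N - k)) subnKC.
have mono (k l : nat) : (k <= l <= N)%N -> {subset f (nth T c k) <= f (nth T c l)}.
  case/andP=> kl lN; apply/f_le; apply: (sorted_leq_nth le_trans le_refl) => //.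
  - exact: sub_sorted (@ltW _ _) _ cP.
  - by rewrite inE sz ltnS (leq_trans kl).
  - by rewrite inE sz ltnS.
apply/negPn/negP => xj.
have lt_ij : (i < j)%N.
  rewrite ltn_neqAle ij andbT; apply/negP => /eqP/val_inj ijE.
  by rewrite -ijE xi in xj.
pose i1 := Ordinal (leq_ltn_trans lt_ij (ltn_ord j)).
(* The last member of the chain is all of [C], so there is a first stage containing [(phi i1, j)];
   it is called [s.+1] below. *)
have ex_s : exists s, (s <= N)%N && ((phi i1, j) \in f (nth T c s)).
  exists N; rewrite leqnn /= (subset_cardP _ (f_sub_C _)) ?inE ?phi_le //.
  by rewrite -NC; apply: rkE.
case: (ex_minnP ex_s) => s /andP[sN ps] smin {ex_s}.
case: s sN ps smin => [|s] sN ps smin.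
  by have := rkE 0 isT; rewrite /rk => /card0_eq/(_ (phi i1, j)); rewrite ps.
have ps' : (phi i1, j) \notin f (nth T c s).
  by apply/negP => ps'; have := smin s; rewrite ltnW // ps' ltnn => /(_ isT).
have ts : (t <= s)%N.
  rewrite leqNgt; apply/negP => st; case/negP: xj.
  apply: (@f_tor _ _ _ i1 _ lt_ij _ xi) => //.
  by rewrite -tT; apply: mono ps; rewrite st -ltnS.
(* Closure brings in [(x, j)] at stage [s.+1] too; it was absent at stage [s], since [x <= phi i1]
   would have forced [(phi i1, j)]. *)
have xs : (x, j) \in f (nth T c s.+1).
  apply: (f_tor lt_ij _ _ ps) => //; apply: (@mono t); first by rewrite sN ltnW.
  by rewrite tT.
have xs' : (x, j) \notin f (nth T c s).
  apply: contra ps' => xs'; apply: (f_up xs'); last exact: phi_le.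
  by apply: le_trans (f_bound xi) _; apply: phi_le.
have px : phi i1 != x.
  by apply: contraL (f_bound xi) => /eqP <-; rewrite lt_geF // phi_lt.
have : (#|(phi i1, j) |: ((x, j) |: [set p in f (nth T c s)])| <= rk (nth T c s.+1))%N.
  apply/subset_leq_card/subsetP => p /setU1P[-> //|/setU1P[-> //|]].
  by rewrite inE; apply: mono; rewrite leqnSn.
rewrite !cardsU1 cardsE -/(rk _) !inE xpair_eqE (negPf px) (negPf ps') (negPf xs') /=.
by rewrite !rkE ?(ltnW sN) // ltnn.
Qed.

(** * Join- and meet-irreducible elements *)

Lemma Tam_card_JIrr : #|JIrr L| = #|C|.
Proof.
have [g gE] := fin_all_exists (fun p => f_onto (slice_tor p)).
have mem_g p : p \in C -> p \in f (g p).
  by rewrite inE gE inE eqxx lexx.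
have g_le p T : p \in f T -> g p <= T.
  case: p => x i xT; apply/f_le => -[y j]; rewrite gE => /and3P[/= /eqP -> xy yi].
  exact: f_up xT xy yi.
have g_inj : {in C &, injective g}.
  move=> [x i] [y j] /mem_g xg /mem_g yg E.
  rewrite E in xg; rewrite -E in yg; move: xg yg; rewrite !gE.
  move=> /and3P[/= /eqP -> yx _] /and3P[/= _ xy _].
  by congr (_, _); apply: le_anti; rewrite xy.
rewrite -(card_in_imset g_inj); apply: eq_card => T; apply/JIrrP/imsetP.
  (* With [T'] the greatest element below [T] and [p] in [T] but not in [T'], the filter of [p] is
     below [T] and not below [T'], so it equals [T]. *)
  case=> T' T'T T'max; have [p [pT pT' _]] := f_lt T'T.
  exists p; first exact: (subsetP (f_sub_C T)).
  apply/eqP/negPn/negP => Tg; case/negP: pT'.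
  have /T'max/f_le : g p < T by rewrite lt_neqAle eq_sym Tg g_le.
  by apply; apply: mem_g; apply: (subsetP (f_sub_C T)).
(* Removing [p] from its principal filter gives the greatest torclosed set strictly below. *)
case=> p pC -> {T}; have [|T TE] := @f_onto [pred q | (q \in slice_gt p) && (q != p)].
  split; first split.
  - by move=> x i /andP[/and3P[]].
  - move=> x y i /andP[/and3P[/= ip px xi] nxp] xy yi.
    rewrite !inE /= ip yi (le_trans px xy) /=; apply: contra nxp => /eqP pE.
    rewrite -pE xpair_eqE eqxx andbT; apply/eqP/le_anti; rewrite xy /=.
    by rewrite -pE in px.
  move=> x i i1 j ij i1E /andP[/and3P[/= /eqP ip _ _] _] /andP[/and3P[/= /eqP jp _ _] _].
  by rewrite ip jp ltnn in ij.
exists T.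
  rewrite lt_leAnge; apply/andP; split.
    by apply/f_le => q; rewrite TE gE => /andP[].
  by apply: (f_nle (mem_g p pC)); rewrite TE inE eqxx andbF.
move=> T' T'g; have /f_le le := ltW T'g; apply/f_le => q qT'.
rewrite TE inE -gE le //=; apply: contraTN T'g => /eqP qE; rewrite qE in qT'.
by rewrite lt_leAnge g_le // andbF.
Qed.

Lemma Tam_card_MIrr : (forall i x, i = 0 :> nat -> phi i <= x) ->
  #|MIrr L| = #|[set u : P * 'I_n * 'I_n | let: (x, j, a) := u in
    [&& x <= phi j, (a <= j)%N, (x <= phi a) ==> (x == phi a) &
     [forall a1 : 'I_n, (a1 == a.+1 :> nat) ==> ~~ (phi a1 <= x)]]]|.
Proof.
move=> phi0; set K := [set u | _].
(* The torclosed sets that are maximal among those avoiding [(x, j)]; [a] is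
   the least index such that either [a = j] or [(phi a.+1, j)] is present. *)
pose M (u : P * 'I_n * 'I_n) := [pred q | let: (x, j, a) := u in
  (q.1 <= phi q.2) && [|| (j < q.2)%N, (q.2 < a)%N |
                         ~~ (q.1 <= x) && ~~ (q.1 <= phi a)]].
have M_tor u : torclosed phi (M u).
  case: u => [[x j] a]; split; first split.
  - by move=> y k /andP[].
  - move=> y z k /andP[/= yk /or3P H] yz zk; rewrite inE /= zk /=.
    case: H => [->//|->|/andP[yx ya]]; first by rewrite orbT.
    by apply/or3P/Or33/andP; split; [apply: contra yx | apply: contra ya];
       apply: le_trans.
  move=> y k k1 l kl k1E /andP[/= yk Hk] /andP[/= k1l Hl]; apply/andP; split=> /=.
    exact: le_trans yk (phi_le (ltnW kl)).
  case/or3P: Hl => [->//|->|/andP[kx ka]]; first by rewrite orbT.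
  (* With [k1 <= a], [phi k1] would be below [phi a]. Once [a <= k < l <= j], membership of [(y, k)]
     comes from the third clause, which does not involve the index. *)
  have ak : (a <= k)%N.
    by rewrite leqNgt -k1E; apply: contra ka; apply: phi_le.
  case: (ltnP j l) => //= lj; move: Hk; rewrite ltnNge (leq_trans (ltnW kl) lj) /=.
  by rewrite ltnNge ak /= => ->; rewrite orbT.
have [g gE] := fin_all_exists (fun u => f_onto (M_tor u)).
have max_g x j a T : (x, j, a) \in K -> g (x, j, a) < T -> (x, j) \in f T.
  rewrite inE => /and4P[xj aj xa /forallP a1x] /f_lt[[y k] [yT yg /f_le gT]].
  (* For [a > 0], component [a.-1] lies wholly in [M]; its bottom and [(phi a, j)] give the bottom
     of component [j]. *)
  have tail : (phi a, j) \in f T -> (x, j) \in f T.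
    move=> aT; case: (posnP a) => [a0|]; first exact: f_up aT (phi0 _ _ a0) xj.
    move=> a_gt0; have lt_a : (a.-1 < a)%N by rewrite prednK.
    have lt_n : (a.-1 < n)%N by apply: ltn_trans lt_a (ltn_ord a).
    pose a' := Ordinal lt_n; pose i0 := Ordinal (leq_ltn_trans (leq0n _) lt_n).
    have i0a' : (phi i0, a') \in f T.
      by apply: gT; rewrite gE inE /= phi_le // lt_a orbT.
    apply: (f_up _ (phi0 i0 x erefl) xj).
    by apply: (@f_tor _ _ a' a j (leq_trans lt_a aj) _ i0a' aT); rewrite /= prednK.
  have tailj : (y, j) \in f T -> (x, j) \in f T.
    have: (y, k) \notin M (x, j, a) by rewrite -gE.
    rewrite inE /= (f_bound yT) /= !negb_or negb_and !negbK => /and3P[_ _ /orP[yx|ya]] yj.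
      exact: f_up yj yx xj.
    by apply: tail; apply: f_up yj ya (phi_le aj).
  have: (y, k) \notin M (x, j, a) by rewrite -gE.
  rewrite inE /= (f_bound yT) /= !negb_or -!leqNgt => /and3P[kj ak _].
  case: (ltngtP k j) kj => // [kj _|/val_inj kj _]; last first.
    by rewrite -kj in tailj *; apply: tailj.
  (* To pass from component [k] to [j], closure needs [(phi k1, j)]; it is in [M] because
     [a < k1]. *)
  apply: tailj; pose k1 := Ordinal (leq_ltn_trans kj (ltn_ord j)).
  apply: (@f_tor _ _ _ k1 _ kj _ yT) => //; apply: gT; rewrite gE inE /= phi_le //=.
  pose a1 := Ordinal (leq_ltn_trans (leq_ltn_trans ak kj) (ltn_ord j)).
  have /negP a1nx : ~~ (phi a1 <= x) by have := a1x a1; rewrite eqxx.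
  apply/or3P/Or33/andP; split; apply/negP.
    by apply: contra_not a1nx => /(le_trans _); apply; apply: phi_le.
  by rewrite lt_geF // phi_lt.
have nmem_g x j (a : 'I_n) : (a <= j)%N -> (x, j) \notin f (g (x, j, a)).
  by move=> aj; rewrite gE inE /= ltnn ltnNge aj lexx andbF.
have g_inj : {in K &, injective g}.
  (* Both [(x, j)] and [(phi a, j)] are missing from [M (x, j, a)]; reading this in the other
     parametrization gives the inequalities. *)
  have half x j (a : 'I_n) x' (j' a' : 'I_n) : (x, j, a) \in K -> (x', j', a') \in K ->
      g (x, j, a) = g (x', j', a') ->
      [/\ (j <= j')%N, (a <= a')%N & (x <= x') || (x <= phi a')].
    rewrite !inE => /and4P[xj aj _ _] /and4P[_ _ _ /forallP a'x'] E.
    have := nmem_g x j a aj.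
    rewrite E gE inE /= xj !negb_or negb_and !negbK -leqNgt => /and3P[jj' _ xx'].
    split=> //; rewrite leqNgt; apply/negP => a'a.
    pose a1 := Ordinal (leq_ltn_trans a'a (ltn_ord a)).
    have /negP := implyP (a'x' a1) (eqxx _); apply.
    have : (phi a, j) \notin f (g (x, j, a)).
      by rewrite gE inE /= lexx ltnn ltnNge aj /= !andbF.
    rewrite E gE inE /= phi_le //= !negb_or negb_and !negbK => /and3P[_ _].
    case/orP=> [|aa']; first by apply: le_trans; apply: phi_le.
    by have := lt_le_trans (phi_lt a'a) aa'; rewrite ltxx.
  move=> [[x j] a] [[x' j'] a'] u u' E.
  have [j1 a1 x1] := half _ _ _ _ _ _ u u' E.
  have [j2 a2 x2] := half _ _ _ _ _ _ u' u (esym E).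
  have aE : a = a' by apply/val_inj/anti_leq; rewrite a1.
  have jE : j = j' by apply/val_inj/anti_leq; rewrite j1.
  subst a' j'; congr (_, _, _); move: u u'; rewrite !inE.
  case/and4P=> _ _ /implyP xa _ /and4P[_ _ /implyP x'a _].
  case: (boolP (x <= phi a)) x1 => [xla _ | _].
    have /eqP xE := xa xla; rewrite xE orbb in x2 *.
    by have /eqP -> := x'a x2.
  rewrite orbF => xx'; case/orP: x2 => [x'x|x'la].
    by apply: le_anti; rewrite xx'.
  by have /eqP x'E := x'a x'la; rewrite x'E in xx' *; apply/eqP/xa.
rewrite -(card_in_imset g_inj); apply: eq_card => T; apply/MIrrP/imsetP.
  case=> T' TT' T'min; have [[x j] [xT' xT /f_le sub]] := f_lt TT'.
  have xj := f_bound xT'.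
  pose A (a : 'I_n) := (a == j) ||
    [exists a1 : 'I_n, [&& a1 == a.+1 :> nat, (a1 <= j)%N & (phi a1, j) \in f T]].
  have [|a aA amin] := @arg_minnP _ j A val; first by rewrite /A eqxx.
  have aj : (a <= j)%N by apply: amin; rewrite /A eqxx.
  have a1T (a1 : 'I_n) : a1 = a.+1 :> nat -> (a1 <= j)%N -> (phi a1, j) \in f T.
    move=> a1E a1j; case/orP: aA => [/eqP aE|]; first by rewrite a1E aE ltnn in a1j.
    by case/existsP=> b /and3P[/eqP bE _]; rewrite (_ : b = a1) //;
       apply: val_inj; rewrite /= bE.
  have xa1 (a1 : 'I_n) : a1 = a.+1 :> nat -> ~~ (phi a1 <= x).
    move=> a1E; apply: contra xT => a1x; case: (leqP a1 j) => a1j.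
      by apply: f_up (a1T _ a1E a1j) a1x xj.
    by have := lt_le_trans (phi_lt a1j) (le_trans a1x xj); rewrite ltxx.
  have Tg : T <= g (x, j, a).
    apply/f_le => -[y k] yT; rewrite gE inE /= (f_bound yT) /=; apply/negPn/negP.
    rewrite !negb_or negb_and !negbK -!leqNgt => /and3P[kj ak].
    have yj : (y, j) \in f T.
      case: (ltngtP k j) kj => // [kj _|/val_inj <- //].
      pose k1 := Ordinal (leq_ltn_trans kj (ltn_ord j)).
      apply: (@f_tor _ _ _ k1 _ kj _ yT) => //.
      pose a1 := Ordinal (leq_ltn_trans (leq_ltn_trans ak kj) (ltn_ord j)).
      by apply: (@f_up _ (phi a1)); rewrite ?phi_le // a1T //= (leq_ltn_trans ak kj).
    case/orP=> [yx|ya]; first by case/negP: xT; apply: f_up yj yx xj.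
    have {yj} aT : (phi a, j) \in f T by apply: f_up yj ya (phi_le aj).
    case: (posnP a) => [a0|a_gt0].
      by case/negP: xT; apply: f_up aT (phi0 _ _ a0) xj.
    have lt_a : (a.-1 < a)%N by rewrite prednK.
    have := amin (Ordinal (ltn_trans lt_a (ltn_ord a))).
    rewrite /A leqNgt /= lt_a => H; suff: false by []; apply: H.
    by apply/orP; right; apply/existsP; exists a; rewrite /= prednK // eqxx aj aT.
  have TE : T = g (x, j, a).
    apply/eqP; move: Tg; rewrite le_eqVlt => /orP[//|/T'min/f_le/(_ _ xT')].
    by rewrite (negPf (nmem_g x j a aj)).
  case: (boolP (x <= phi a)) => [xa|nxa]; last first.
    exists (x, j, a) => //; rewrite inE xj aj (negPf nxa) /=.
    by apply/forallP => a1; apply/implyP => /eqP; apply: xa1.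
  (* When [x <= phi a], replacing [x] by [phi a] leaves the set unchanged and meets the
     normalization in [K]. *)
  exists (phi a, j, a).
    rewrite inE phi_le // aj eqxx implybT /=.
    apply/forallP => a1; apply/implyP => /eqP a1E.
    by rewrite lt_geF // phi_lt // a1E.
  rewrite TE; apply: f_eq => -[y k]; rewrite !gE !inE /=; congr (_ && [|| _, _ | _]).
  rewrite -!negb_or orbb; case: (boolP (y <= phi a)) => //=; first by rewrite orbT.
  by rewrite orbF => nya; apply: contra nya => /le_trans; apply.
case=> -[[x j] a] u -> {T}; have aj : (a <= j)%N by move: u; rewrite inE => /and4P[].
have xj : x <= phi j by move: u; rewrite inE => /and4P[].
(* The intersection of all torclosed sets strictly above [g (x, j, a)]; by [max_g] it contains
   [(x, j)], so it is itself strictly above. *)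
have [|T TE] := @f_onto [pred q | (q \in C) &&
    [forall T : L, (g (x, j, a) < T) ==> (q \in f T)]].
  split; first split.
  - by move=> y k; rewrite !inE => /andP[].
  - move=> y z k; rewrite !inE /= => /andP[_ /forallP yA] yz zk; rewrite zk.
    by apply/forallP => T; apply/implyP => gT; apply: f_up (implyP (yA T) gT) yz zk.
  move=> y k k1 l kl k1E; rewrite !inE /= => /andP[yk /forallP yA] /andP[_ /forallP k1A].
  rewrite (le_trans yk (phi_le (ltnW kl))) /=; apply/forallP => T; apply/implyP => gT.
  exact: f_tor kl k1E (implyP (yA T) gT) (implyP (k1A T) gT).
exists T => [|T' gT']; last first.
  by apply/f_le => q; rewrite TE => /andP[_ /forallP/(_ T')/implyP]; apply.
rewrite lt_leAnge; apply/andP; split.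
  apply/f_le => q qg; rewrite TE inE (subsetP (f_sub_C _) _ qg) /=.
  by apply/forallP => T'; apply/implyP => /ltW/f_le; apply.
apply: (@f_nle _ _ (x, j)); last exact: nmem_g.
rewrite TE !inE xj /=; apply/forallP => T'; apply/implyP; exact: max_g.
Qed.

End Tamari.

(** * Sums over non-decreasing sequences *)

Section NondecreasingSeqs.

(** The recursion fixes the last entry [i], which bounds the others; sums then telescope by Pascal's
    rule. *)
Fixpoint nondecr_seqs (m n : nat) : seq (seq nat) :=
  if m is m'.+1 then [seq rcons s i | i <- iota 0 n, s <- nondecr_seqs m' i.+1]
  else [:: [::]].

Arguments nondecr_seqs : simpl never.

Lemma mem_nondecr_seqs m n s :
  (s \in nondecr_seqs m n) = [&& size s == m, sorted leq s & all (ltn^~ n) s].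
Proof.
elim: m n s => [|m IHm] n s; first by case: s.
apply/allpairsPdep/and3P => [[i [t []]]|].
  rewrite mem_iota IHm /= add0n => i_n /and3P[/eqP st t_sorted /allP ti] ->.
  rewrite size_rcons st eqxx all_rcons i_n; split=> //.
    case: t {st} t_sorted ti => //= a t; rewrite rcons_path => -> ti.
    by have := ti _ (mem_last a t).
  by apply/allP => a /ti /= /leq_trans; apply.
case: (lastP s) => [[]//|t i]; rewrite size_rcons eqSS all_rcons => -[st t_sorted].
case/andP=> i_n t_n; exists i, t; rewrite mem_iota [t \in _]IHm st; split=> //.
move: t_sorted; rewrite -[rcons t i]revK rev_sorted rev_rcons /=.
rewrite (path_sortedE (rev_trans leq_trans)) all_rev => /andP[/allP ti].
by rewrite rev_sorted => -> /=; apply/allP => a /ti.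
Qed.

Lemma nondecr_seqs_uniq m n : uniq (nondecr_seqs m n).
Proof.
elim: m n => // m IHm n; apply: allpairs_uniq_dep; first exact: iota_uniq.
  by move=> i _; apply: IHm.
by move=> [i s] [j t] _ _ /= /rcons_inj[-> ->].
Qed.

Lemma sum_nondecr_seqs m n (F : seq nat -> nat) :
  \sum_(s <- nondecr_seqs m.+1 n) F s =
  \sum_(i < n) \sum_(s <- nondecr_seqs m i.+1) F (rcons s i).
Proof. by rewrite big_allpairs_dep -{1}[n]subn0 -/(index_iota 0 n) big_mkord. Qed.

(** The hockey-stick identity; [m <= k] makes the initial term ['C(m, k.+1)] vanish. *)
Lemma sum_bin_shift m k n : (m <= k)%N -> \sum_(i < n) 'C(i + m, k) = 'C(n + m, k.+1).
Proof.
move=> mk; elim: n => [|n IHn]; first by rewrite big_ord0 bin_small // ltnS.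
by rewrite big_ord_recr /= IHn addSn binS.
Qed.

Lemma size_nondecr_seqs m n : size (nondecr_seqs m n.+1) = 'C(n + m, m).
Proof.
elim: m n => [|m IHm] n; first by rewrite bin0.
rewrite -sum1_size sum_nondecr_seqs.
under eq_bigr do rewrite sum1_size IHm.
by rewrite sum_bin_shift // addSnnS.
Qed.

Lemma sum_nth_nondecr_seqs m n k : (k <= m)%N ->
  \sum_(s <- nondecr_seqs m.+1 n) nth 0 s k = k.+1 * 'C(n + m, m.+2).
Proof.
elim: m n => [|m IHm] n km; rewrite sum_nondecr_seqs.
  move: km; rewrite leqn0 => /eqP ->; rewrite mul1n -(sum_bin_shift _ (leq0n 1)).
  by apply: eq_bigr => i _; rewrite big_seq1 addn0 bin1.
move: km; rewrite leq_eqVlt => /predU1P[->|]; last first.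
  rewrite ltnS => km; rewrite -sum_bin_shift // big_distrr /=; apply: eq_bigr => i _.
  rewrite addnS -addSn -IHm // big_seq [RHS]big_seq; apply: eq_bigr => s.
  by rewrite mem_nondecr_seqs => /andP[/eqP sm _]; rewrite nth_rcons sm ltnS km.
(* The last coordinate is [i] on ['C(i + m.+1, m.+1)] sequences, and [mul_bin_left] turns the
   product into [m.+2 * 'C(i + m.+1, m.+2)]. *)
rewrite -sum_bin_shift // big_distrr /=; apply: eq_bigr => i _.
rewrite mul_bin_left addnK -size_nondecr_seqs -sum1_size mulnC big_distrl /=.
rewrite big_seq [RHS]big_seq; apply: eq_bigr => s.
rewrite mem_nondecr_seqs => /andP[/eqP sm _].
by rewrite nth_rcons sm ltnn eqxx mul1n.
Qed.

End NondecreasingSeqs.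

(** * Coordinates of elements of os_n^m *)

Section OsCoordinates.
Context {n : nat}.

(** Lists of naturals can be matched with [nondecr_seqs], and [nth] allows indices that are plain
    naturals. *)
Definition os_seq m (x : os n m) : seq nat := [seq val i | i <- os_val x].

Lemma size_os_seq m (x : os n m) : size (os_seq x) = m.
Proof. by rewrite size_map size_tuple. Qed.

Lemma nth_os_seq m (x : os n m) (i : 'I_m) : nth 0 (os_seq x) i = coord x i.
Proof.
by rewrite /coord (tnth_nth (coord x i)) (nth_map (coord x i)) // size_tuple.
Qed.

Lemma nth_os_seq_lt m (x : os n m) t : (t < m)%N -> (nth 0 (os_seq x) t < n)%N.
Proof. by move=> tm; rewrite (nth_os_seq x (Ordinal tm)). Qed.

Lemma nth_os_seq_le m (x : os n m) t u :
  (t <= u < m)%N -> (nth 0 (os_seq x) t <= nth 0 (os_seq x) u)%N.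
Proof.
case/andP=> tu um; have tm := leq_ltn_trans tu um.
rewrite (nth_os_seq x (Ordinal tm)) (nth_os_seq x (Ordinal um)).
by have /forallP/(_ (Ordinal tm))/forallP/(_ (Ordinal um))/implyP := os_valP x; apply.
Qed.

Lemma leEos_seq m (x y : os n m) :
  reflect (forall t, (t < m)%N -> (nth 0 (os_seq x) t <= nth 0 (os_seq y) t)%N) (x <= y).
Proof.
rewrite leEos; apply: (iffP forallP) => [xy t tm|xy i].
  by rewrite !(nth_os_seq _ (Ordinal tm)).
by rewrite -!nth_os_seq xy.
Qed.

Lemma os_seq_inj m : injective (@os_seq m).
Proof.
move=> x y xy; apply: le_anti; apply/andP.
by split; apply/leEos_seq => t; rewrite xy.
Qed.

Lemma ex_os m (g : nat -> nat) :
  (forall t u, (t <= u < m)%N -> (g t <= g u)%N) ->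
  (forall t, (t < m)%N -> (g t < n)%N) ->
  exists x : os n m, forall t, (t < m)%N -> nth 0 (os_seq x) t = g t.
Proof.
move=> g_mono g_lt; pose v := [tuple Ordinal (g_lt t (ltn_ord t)) | t < m].
have vP : nondecr v.
  apply/forallP => t; apply/forallP => u; apply/implyP => tu.
  by rewrite !tnth_mktuple /= g_mono // tu /=.
exists (Os vP) => t tm; rewrite (nth_os_seq _ (Ordinal tm)).
by rewrite /coord tnth_mktuple.
Qed.

Lemma mem_os_seq m s : (s \in codom (@os_seq m)) = (s \in nondecr_seqs m n).
Proof.
rewrite mem_nondecr_seqs; apply/codomP/and3P => [[x ->]|[/eqP sm s_sorted /allP s_lt]].
  rewrite size_os_seq; split=> //.
    by apply/(sortedP 0) => t; rewrite size_os_seq => tm; rewrite nth_os_seq_le // leqnSn.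
  by apply/allP => _ /mapP[i _ ->] /=.
have [t u /andP[tu um]|t tm|x xE] := @ex_os m (nth 0 s).
- by apply: sorted_leq_nth; rewrite // ?inE ?sm ?(leq_ltn_trans tu um) //;
     apply: leq_trans.
- by apply: s_lt; rewrite mem_nth ?sm.
exists x; apply: (@eq_from_nth _ 0) => [|t]; rewrite ?size_os_seq ?sm // => tm.
by rewrite xE.
Qed.

Lemma sum_os m (F : seq nat -> nat) :
  \sum_(x : os n m) F (os_seq x) = \sum_(s <- nondecr_seqs m n) F s.
Proof.
rewrite (perm_big (codom (@os_seq m)));
  first by rewrite /codom /image_mem big_map big_enum.
rewrite perm_sym.
apply: uniq_perm => [||s]; rewrite ?nondecr_seqs_uniq ?mem_os_seq //.
by rewrite map_inj_uniq ?enum_uniq //; apply: os_seq_inj.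
Qed.

Lemma os_init_seq m (x : os n m.+1) t : (t < m)%N ->
  nth 0 (os_seq (os_init x)) t = nth 0 (os_seq x) t.
Proof.
move=> tm; rewrite (nth_os_seq _ (Ordinal tm)) /coord tnth_mktuple.
by rewrite -nth_os_seq.
Qed.

Lemma os_last_seq m (x : os n m.+1) : os_last x = nth 0 (os_seq x) m :> nat.
Proof. by rewrite -nth_os_seq. Qed.

Lemma os_diag_seq m (i : 'I_n) t : (t < m)%N -> nth 0 (os_seq (os_diag m i)) t = i.
Proof. by move=> tm; rewrite (nth_os_seq _ (Ordinal tm)) /coord tnth_mktuple. Qed.

Lemma le_os_diag m (x : os n m) (i : 'I_n) :
  reflect (forall t, (t < m)%N -> (nth 0 (os_seq x) t <= i)%N) (x <= os_diag m i).
Proof.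
by apply: (iffP (leEos_seq _ _)) => xi t tm; have := xi t tm; rewrite os_diag_seq.
Qed.

Lemma os_diag_le m (x : os n m) (i : 'I_n) :
  reflect (forall t, (t < m)%N -> (i <= nth 0 (os_seq x) t)%N) (os_diag m i <= x).
Proof.
by apply: (iffP (leEos_seq _ _)) => xi t tm; have := xi t tm; rewrite os_diag_seq.
Qed.

Lemma os_diag_lt m (i j : 'I_n) : (0 < m)%N -> (i < j)%N -> os_diag m i < os_diag m j.
Proof.
move=> m_gt0 ij; rewrite lt_leAnge; apply/andP; split.
  by apply/le_os_diag => t tm; rewrite os_diag_seq // ltnW.
by apply/le_os_diag => /(_ 0 m_gt0); rewrite os_diag_seq // leqNgt ij.
Qed.

Lemma os_split_le m (x y : os n m.+1) :
  (x <= y) = (os_init x <= os_init y) && (os_last x <= os_last y)%N.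
Proof.
apply/leEos_seq/andP => [xy|[/leEos_seq xy xy_last] t].
  split; last by rewrite !os_last_seq xy.
  by apply/leEos_seq => t tm; rewrite !os_init_seq // xy // ltnW.
rewrite ltnS leq_eqVlt => /predU1P[->|tm]; first by rewrite -!os_last_seq.
by rewrite -!os_init_seq ?xy.
Qed.

Lemma os_split_inj m : injective (@os_split n m).
Proof.
move=> x y xy; have xy1 : os_init x = os_init y := congr1 fst xy.
have xy2 : os_last x = os_last y := congr1 snd xy.
by apply: le_anti; rewrite !os_split_le xy1 xy2 lexx leqnn.
Qed.

Lemma os_init_le_diag m (x : os n m.+1) : os_init x <= os_diag m (os_last x).
Proof.
apply/le_os_diag => t tm; rewrite os_init_seq // os_last_seq.
by rewrite nth_os_seq_le // ltnW //= ltnS.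
Qed.

Lemma os_split_onto m (x : os n m) (i : 'I_n) :
  x <= os_diag m i -> exists c, os_split c = (x, i).
Proof.
move=> /le_os_diag xi.
have [t u /andP[tu um]|t tm|c cE] :=
  @ex_os m.+1 (fun t => if (t < m)%N then nth 0 (os_seq x) t else i).
- case: ifP => tm; case: ifP => um' //; last by rewrite (leq_ltn_trans tu um') in tm.
    by rewrite nth_os_seq_le ?tu.
  exact: xi.
- by case: ifP => [/nth_os_seq_lt //|].
exists c; congr (_, _).
  apply: os_seq_inj; apply: (@eq_from_nth _ 0) => [|t]; rewrite !size_os_seq // => tm.
  by rewrite os_init_seq // cE ?tm // ltnW.
by apply: val_inj; rewrite /= os_last_seq cE // ltnn.
Qed.

End OsCoordinates.

(** * d-torsion classes *)

Section DTorsion.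
Context {n d : nat}.
Implicit Types (T : {set os n d.+1}) (c : os n d.+1).

Lemma dtorsion_slice T c e :
  is_dtorsion T -> c \in T -> os_last e = os_last c -> c <= e -> e \in T.
Proof.
case/andP=> /forallP/(_ c) H _ cT ec ce; move: H; rewrite cT => /forallP/(_ e).
by rewrite ec eqxx ce.
Qed.

Lemma interlacedI (x z : os n d.+1) :
  (forall t, (t <= d)%N -> (nth 0 (os_seq x) t < nth 0 (os_seq z) t)%N) ->
  (forall t, (t < d)%N -> (nth 0 (os_seq z) t <= (nth 0 (os_seq x) t.+1).+1)%N) ->
  interlaced x z.
Proof.
move=> xz zx; apply/andP; split; apply/forallP => i.
  by rewrite -!nth_os_seq xz // -ltnS.
apply/forallP => j; apply/implyP => /eqP ji; rewrite -!nth_os_seq ji.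
by rewrite leq_subLR add1n zx // -ltnS -ji.
Qed.

Lemma dtorsion_mixing T c e :
  is_dtorsion T -> c \in T -> e \in T -> interlaced c e ->
  forall y, (forall t, (t <= d)%N ->
    nth 0 (os_seq y) t = nth 0 (os_seq c) t \/ nth 0 (os_seq y) t = nth 0 (os_seq e) t) ->
  y \in T.
Proof.
case/andP=> _ /forallP/(_ c) H cT eT ce y yce; move: H; rewrite cT /=.
move/forallP/(_ e); rewrite eT /= => /forallP/(_ y)/implyP; apply; rewrite ce /=.
apply/forallP => i; rewrite !inE; apply/orP.
by have := yce i (ltn_ord i); rewrite !nth_os_seq => -[] /val_inj ->; [left|right].
Qed.

Lemma dtorsion_torclosed T : (0 < d)%N -> is_dtorsion T ->
  torclosed (@os_diag n d) (mem [set os_split x | x in T]).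
Proof.
move=> d_gt0 T_tors; split; first split.
- by move=> x i /imsetP[c _ [-> ->]]; apply: os_init_le_diag.
- move=> x y i /imsetP[c cT [xE iE]] xy yi; have [e eE] := os_split_onto yi.
  rewrite -eE; apply/imset_f/(dtorsion_slice T_tors cT).
    by rewrite -iE; case: eE.
  by rewrite os_split_le; case: eE => -> ->; rewrite -xE -iE xy leqnn.
move=> x i i1 j ij i1E /imsetP[c cT xi_c] /imsetP[e eT i1j].
have i1_init : os_diag d i1 = os_init e := congr1 fst i1j.
have jE : j = os_last e := congr1 snd i1j.
have xE : x = os_init c := congr1 fst xi_c.
have iE : i = os_last c := congr1 snd xi_c.
have xi : x <= os_diag d i by rewrite xE iE os_init_le_diag.
pose cc t := nth 0 (os_seq c) t.
have cc_mono t u : (t <= u <= d)%N -> (cc t <= cc u)%N.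
  by move=> tud; apply: nth_os_seq_le; rewrite ltnS.
have cc_i : cc d = i by rewrite iE os_last_seq.
have cc_le t : (t <= d)%N -> (cc t <= i)%N.
  by move=> td; rewrite -cc_i cc_mono ?td /=.
have cc_lt t : (t <= d)%N -> (cc t < n)%N by move=> td; apply: nth_os_seq_lt.
have e_last : nth 0 (os_seq e) d = j by rewrite jE os_last_seq.
have e_init t : (t < d)%N -> nth 0 (os_seq e) t = i.+1.
  by move=> td; rewrite -os_init_seq // -i1_init os_diag_seq.
(* [(x_1, ..., x_k, i, ..., i, j)] is in [T] for all [k], by induction on [k]:
   it mixes [(x_1, ..., x_{k+1}, i, ..., i, i)] with
   [(x_2 + 1, ..., x_{k+1} + 1, i + 1, ..., i + 1, j)], which is in [T] since it
   is above the element obtained at the previous step. *)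
pose W k t := if t == d then j : nat else if (t < k)%N then cc t else i : nat.
have W_in k w : (k <= d)%N -> (forall t, (t <= d)%N -> nth 0 (os_seq w) t = W k t) ->
    w \in T.
  elim: k w => [|k IHk] w kd wE.
    (* Base case: [(i, ..., i, j)] mixes [(i, ..., i)] and [e = (i.+1, ..., i.+1, j)]. *)
    have iT : os_diag d.+1 i \in T.
      apply: (dtorsion_slice T_tors cT).
        by apply: val_inj; rewrite /= !os_last_seq os_diag_seq.
      by apply/le_os_diag => t td; apply: cc_le; rewrite -ltnS.
    apply: (dtorsion_mixing T_tors iT eT).
      apply: interlacedI => t td; rewrite os_diag_seq ?ltnS ?(ltnW td) //.
        by move: td; rewrite leq_eqVlt => /predU1P[->|/e_init->]; rewrite ?e_last.
      by rewrite e_init.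
    move=> t td; rewrite wE // os_diag_seq // /W ltn0.
    by case: eqP => [->|_]; [right; rewrite e_last | left].
  have [t u /andP[tu ud]|t td|x' x'E] :=
    @ex_os n d.+1 (fun t => if (t <= k)%N then cc t else i : nat).
  - case: (leqP t k) => tk; case: (leqP u k) => uk //; first by rewrite cc_mono ?tu.
      by rewrite cc_le // -ltnS (leq_ltn_trans tu ud).
    by rewrite leqNgt (leq_trans tk tu) in uk.
  - by case: ifP => _ //; apply: cc_lt.
  have x'T : x' \in T.
    apply: (dtorsion_slice T_tors cT).
      by apply: val_inj; rewrite /= !os_last_seq x'E // leqNgt kd -os_last_seq -iE.
    by apply/leEos_seq => t td; rewrite x'E //; case: ifP => // _; apply: cc_le.
  have [t u /andP[tu ud]|t td|w' w'E] := @ex_os n d.+1 (W k).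
  - rewrite /W; case: (u =P d) => [_|/eqP nud].
      case: (t =P d) => // _; case: ifP => _; last exact: ltnW.
      by apply: leq_trans (ltnW ij); rewrite cc_le // -ltnS (leq_ltn_trans tu ud).
    have ud' : (u < d)%N by rewrite ltn_neqAle nud -ltnS.
    rewrite (ltn_eqF (leq_ltn_trans tu ud')).
    case: (ltnP t k) => tk; case: (ltnP u k) => uk //; first by rewrite cc_mono ?tu.
      by rewrite cc_le // (leq_trans tu (ltnW ud')).
    by rewrite ltnNge (leq_trans tk tu) in uk.
  - by rewrite /W; case: eqP => // _; case: ifP => _ //; apply: cc_lt.
  have w'T : w' \in T by apply: IHk (ltnW kd) _ => t td; rewrite w'E.
  (* Before the last coordinate, [Z t] is the successor of coordinate [t.+1] of [x'], the largest
     value that interlacing allows. *)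
  pose Z t := if t == d then j : nat else if (t < k)%N then (cc t.+1).+1 else i.+1.
  have Z_lt t : (t < d)%N -> (Z t <= i.+1)%N.
    by move=> td; rewrite /Z ltn_eqF //; case: ifP => // _; apply: cc_le.
  have [t u /andP[tu ud]|t|z zE] := @ex_os n d.+1 Z.
  - rewrite {2}/Z; case: (u =P d) => [_|/eqP nud].
      case: (t =P d) => [->|/eqP ntd]; first by rewrite /Z eqxx.
      by apply: leq_trans ij; apply: Z_lt; rewrite ltn_neqAle ntd (leq_trans tu).
    have ud' : (u < d)%N by rewrite ltn_neqAle nud -ltnS.
    have td := leq_ltn_trans tu ud'.
    case: (ltnP u k) => uk; last exact: Z_lt.
    by rewrite /Z (ltn_eqF td) (leq_ltn_trans tu uk) ltnS cc_mono // ltnS tu.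
  - rewrite ltnS leq_eqVlt => /predU1P[->|td]; first by rewrite /Z eqxx.
    by apply: leq_ltn_trans (Z_lt _ td) _; rewrite -i1E.
  have zT : z \in T.
    apply: (dtorsion_slice T_tors w'T).
      by apply: val_inj; rewrite /= !os_last_seq zE // w'E // /Z /W eqxx.
    apply/leEos_seq => t td; rewrite zE // w'E // /Z /W.
    case: eqP => // /eqP ntd; case: ifP => _ //; apply/ltnW.
    by rewrite ltnS cc_mono // leqnSn ltn_neqAle ntd -ltnS.
  apply: (dtorsion_mixing T_tors x'T zT).
    apply: interlacedI => t td; rewrite x'E // zE ?ltnS ?(ltnW td) // /Z.
      case: (t =P d) td => [-> _|/eqP ntd td]; first by rewrite (leqNgt d k) kd.
      case: (ltnP t k) => tk.
        by rewrite (ltnW tk) ltnS cc_mono // leqnSn ltn_neqAle ntd.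
      by case: ifP => _; rewrite ltnS // cc_le.
    by rewrite (ltn_eqF td); case: ifP.
  (* The target takes its last coordinate from [z] and all others from [x']. *)
  move=> t td; rewrite wE // x'E // zE // /W /Z ltnS.
  by case: eqP => _; [right | left].
have xj : x <= os_diag d j by apply: le_trans xi (ltW (os_diag_lt d_gt0 ij)).
have [w wE] := os_split_onto xj; rewrite -wE; apply/imset_f/(W_in d) => // t.
have w_init : os_init w = os_init c by rewrite -xE; case: wE.
rewrite /W leq_eqVlt => /predU1P[->|td].
  by rewrite eqxx -os_last_seq; case: wE => _ ->.
by rewrite td (ltn_eqF td) -os_init_seq // w_init os_init_seq.
Qed.

(** A mixture ending like [x] is above [x] in the same slice. If it ends like [z], interlacing
    bounds the other coordinates of [z] by [os_last x + 1], so the filter condition yields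
    [(os_diag d i1, os_last z)] and closure applies. *)
Lemma torclosed_dtorsion (U : {pred os n d * 'I_n}) :
  torclosed (@os_diag n d) U -> is_dtorsion [set c | os_split c \in U].
Proof.
move=> [[U_bound U_up] U_tor]; apply/andP; split.
  apply/'forall_implyP => c; rewrite inE => cU; apply/forallP => e; apply/implyP.
  case/andP=> /eqP ec; rewrite os_split_le => /andP[ce _]; rewrite inE.
  move: cU; rewrite /os_split ec => cU; apply: U_up cU ce _.
  by rewrite -ec os_init_le_diag.
apply/'forall_implyP => x; rewrite inE => xU.
apply/'forall_implyP => z; rewrite inE => zU.
apply/forallP => y; apply/implyP => /andP[/andP[/forallP xz /forallP zx] /forallP yxz].
rewrite inE; have xy : x <= y.
  rewrite leEos; apply/forallP => t; have := yxz t; rewrite !inE.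
  by case/orP=> /eqP -> //; apply/ltnW/xz.
move: xy; rewrite os_split_le => /andP[xy _].
have /orP[/eqP yE|/eqP yE] :
    (coord y ord_max == coord x ord_max) || (coord y ord_max == coord z ord_max).
  by have := yxz ord_max; rewrite !inE.
  apply: (U_up (os_init x)) => //; last exact: os_init_le_diag.
  by rewrite /os_last yE.
have lt_xz : (os_last x < os_last z)%N := xz ord_max.
pose i1 := Ordinal (leq_ltn_trans lt_xz (ltn_ord (os_last z))).
have i1U : (os_diag d i1, os_last z) \in U.
  apply: (U_up (os_init z)) => //; last by apply/le_os_diag => t td; rewrite os_diag_seq.
  apply/le_os_diag => t td; rewrite os_init_seq //.
  have td1 : (t.+1 < d.+1)%N by [].
  have := implyP (forallP (zx (Ordinal (ltnW td1))) (Ordinal td1)) (eqxx _).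
  rewrite -!nth_os_seq leq_subLR add1n /= => /leq_trans; apply; rewrite ltnS os_last_seq.
  by rewrite nth_os_seq_le // td ltnSn.
apply: (U_up (os_init x)) => //; last exact: os_init_le_diag.
by rewrite [os_last y]yE; apply: (U_tor _ (os_last x) i1).
Qed.

Lemma dtors_Tam_iso : (0 < d)%N ->
  Tam_iso (@os_diag n d) (fun T : dtors n d => mem [set os_split x | x in dtors_val T]).
Proof.
move=> d_gt0; split.
- by move=> x; exists (enum {: os n d}) => y _; rewrite mem_enum.
- by move=> i j; apply: os_diag_lt.
- by move=> T; apply/dtorsion_torclosed/dtors_valP.
- move=> T1 T2; rewrite leEdtors; split=> [/subsetP T12 _ /imsetP[c /T12 cT ->]|T12].
    exact: imset_f.
  apply/subsetP => c cT.
  have /T12/imsetP[e eT /os_split_inj ->] // :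
    os_split c \in [set os_split x | x in dtors_val T1].
  exact: imset_f.
move=> U U_tor; exists (DTors (torclosed_dtorsion U_tor)) => -[x i] /=.
apply/imsetP/idP => [[c]|xU]; first by rewrite inE => cU ->.
have [[U_bound _] _] := U_tor; have [c cE] := os_split_onto (U_bound _ _ xU).
by exists c; rewrite ?inE cE.
Qed.

End DTorsion.

(** * Meet-irreducible d-torsion classes *)

Section Counting.
Context {n : nat}.

Lemma card_os m : #|{: os n m.+1}| = 'C(n + m, m.+1).
Proof.
rewrite -sum1_card (sum_os _ (fun _ => 1)) sum_nondecr_seqs -(sum_bin_shift n (leqnn m)).
by apply: eq_bigr => i _; rewrite sum1_size size_nondecr_seqs.
Qed.

Lemma sum_coord_os m k : (k <= m)%N ->
  \sum_(x : os n m.+1) nth 0 (os_seq x) k = k.+1 * 'C(n + m, m.+2).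
Proof. by move=> km; rewrite (sum_os _ (fun s => nth 0 s k)) sum_nth_nondecr_seqs. Qed.

Lemma card_ord_lt v : (v <= n)%N -> #|[pred a : 'I_n | (a < v)%N]| = v.
Proof.
by move=> vn; rewrite -sum1_card -(big_ord_widen _ (fun=> 1) vn) sum1_card card_ord.
Qed.

Lemma card_ord_interval u v : (u <= v <= n)%N ->
  #|[pred a : 'I_n | (u <= a < v)%N]| = v - u.
Proof.
case/andP=> uv vn; rewrite -{2}(card_ord_lt vn).
rewrite -(cardID [pred a : 'I_n | (a < u)%N] [pred a : 'I_n | (a < v)%N]).
rewrite [X in _ = X + _ - _](_ : _ = u).
  by rewrite addKn; apply: eq_card => a; rewrite !inE -leqNgt.
rewrite -[RHS](card_ord_lt (leq_trans uv vn)); apply: eq_card => a; rewrite !inE.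
by rewrite andb_idl // => /leq_trans; apply.
Qed.

Lemma card_os_split m :
  #|[set p : os n m * 'I_n | p.1 <= os_diag m p.2]| = #|{: os n m.+1}|.
Proof.
rewrite -(card_imset _ (@os_split_inj n m)); apply: eq_card => -[x i]; rewrite inE /=.
apply/idP/imsetP => [/os_split_onto[c cE]|[c _ [-> ->]]]; first by exists c; rewrite ?cE.
exact: os_init_le_diag.
Qed.

Lemma card_ord_pairs : #|[set u : 'I_n * 'I_n | (u.2 <= u.1)%N]| = (n * n.+1) %/ 2.
Proof.
rewrite divn2 mulnC -(bin2 n.+1) -[n.+1]addn1 -sum_bin_shift // -sum1dep_card.
rewrite -(pair_big_dep xpredT (fun j a : 'I_n => (a <= j)%N) (fun _ _ => 1)) /=.
by apply: eq_bigr => j _; rewrite sum1_card (card_ord_lt (ltn_ord j)) addn1 bin1.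
Qed.

Lemma card_MIrr_index d : (0 < d)%N ->
  #|[set u : os n d * 'I_n * 'I_n | let: (x, j, a) := u in
    [&& x <= os_diag d j, (a <= j)%N, (x <= os_diag d a) ==> (x == os_diag d a) &
     [forall a1 : 'I_n, (a1 == a.+1 :> nat) ==> ~~ (os_diag d a1 <= x)]]]| =
  (d - 1) * 'C(n + d, d.+2) + (n * n.+1) %/ 2.
Proof.
case: d => // d _; rewrite subn1 /=; set K := [set u | _].
pose D := [set u : os n d.+1 * 'I_n * 'I_n | u.1.1 == os_diag d.+1 u.2].
rewrite -(cardsID D) addnC; congr (_ + _).
  (* Coordinates are numbered from 0: [d] is the last one of [x], and [d.+1] carries [j]. Not being
     below [os_diag a] means that coordinate [d] exceeds [a]; not being above the next diagonal,
     that coordinate 0 is at most [a]. *)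
  have -> : K :\: D = [set (os_split v.1, v.2) | v in
      [set v : os n d.+2 * 'I_n |
        (nth 0 (os_seq v.1) 0 <= v.2 < nth 0 (os_seq v.1) d)%N]].
    apply/setP => -[[x j] a]; rewrite !inE /=; apply/andP/imsetP.
      case=> /negPf xa /and4P[/os_split_onto[c cE] aj nxa /forallP nax].
      exists (c, a); rewrite ?cE // inE /=.
      have xE : os_init c = x := congr1 fst cE.
      rewrite xa implybF in nxa; apply/andP; split.
        rewrite leqNgt; apply/negP => a_c.
        pose a1 := Ordinal (leq_ltn_trans a_c (nth_os_seq_lt c (ltn0Sn _))).
        case/negP: (implyP (nax a1) (eqxx _)); apply/os_diag_le => t td.
        rewrite -xE os_init_seq //; apply: (leq_trans a_c).
        by apply: nth_os_seq_le; apply: (leq_trans td).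
      rewrite ltnNge; apply: contra nxa => c_a; apply/le_os_diag => t td.
      rewrite -xE os_init_seq //; apply: leq_trans c_a; apply: nth_os_seq_le.
      by rewrite -ltnS td ltnS leqnSn.
    case=> -[c b]; rewrite inE /= => /andP[cb bc] [-> -> ->].
    have nle : ~~ (os_init c <= os_diag d.+1 b).
      by apply/negP => /le_os_diag/(_ d (ltnSn _)); rewrite os_init_seq // leqNgt bc.
    split; first by apply: contra nle => /eqP ->.
    rewrite os_init_le_diag (negPf nle) /=; apply/andP; split.
      rewrite os_last_seq; apply: leq_trans (ltnW bc) _; apply: nth_os_seq_le.
      by rewrite leqnSn ltnSn.
    apply/forallP => a1; apply/implyP => /eqP a1E.
    apply/negP => /os_diag_le/(_ 0 (ltn0Sn _)).
    by rewrite os_init_seq // a1E ltnNge cb.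
  rewrite card_imset => [|[c a] [c' a'] E]; last first.
    congr (_, _); last exact: (congr1 snd E).
    exact: os_split_inj (congr1 fst E).
  rewrite -sum1dep_card.
  rewrite -(pair_big_dep xpredT (fun (c : os n d.+2) (a : 'I_n) =>
    (nth 0 (os_seq c) 0 <= a < nth 0 (os_seq c) d)%N) (fun _ _ => 1)) /=.
  transitivity (\sum_(c : os n d.+2) (nth 0 (os_seq c) d - nth 0 (os_seq c) 0)).
    apply: eq_bigr => c _; rewrite sum1_card card_ord_interval //.
    by rewrite nth_os_seq_le ?ltnS ?leqnSn // ltnW // nth_os_seq_lt ?ltnS ?leqnSn.
  rewrite sumnB => [|c _]; last by rewrite nth_os_seq_le ?ltnS ?leqnSn.
  by rewrite !sum_coord_os // mul1n mulSn addKn.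
rewrite -card_ord_pairs.
have -> : K :&: D = [set (os_diag d.+1 v.2, v.1, v.2) | v in
    [set v : 'I_n * 'I_n | (v.2 <= v.1)%N]].
  apply/setP => -[[x j] a]; rewrite !inE /=; apply/andP/imsetP.
    case=> /and4P[_ aj _ _] /eqP ->; by exists (j, a); rewrite ?inE.
  case=> -[k b]; rewrite inE /= => bk [-> -> ->]; split=> //.
  rewrite bk eqxx implybT /=; apply/andP; split.
    by apply/le_os_diag => t td; rewrite os_diag_seq.
  by apply/forallP => a1; apply/implyP => /eqP a1E; rewrite lt_geF // os_diag_lt // a1E.
by rewrite card_imset // => -[j a] [j' a'] [_ -> ->].
Qed.

End Counting.

(** * Specialization to os_n^d and its diagonal chain *)

Theorem corollary4p17 (n d : nat) (n_gt0 : (0 < n)%N) (d_gt0 : (0 < d)%N) :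
  [/\ Tam_iso (@os_diag n d)
        (fun T : dtors n d => mem [set os_split x | x in dtors_val T]),
      join_semidistributive (dtors n d),
      semidistributive (dtors n d) <-> (n <= 2)%N \/ d = 1%N
    & [/\ [set dtors_val T | T in spine (dtors n d)] = J (os n d.+1)^d,
          lattice_length (dtors n d) = #|JIrr (dtors n d)|,
          #|JIrr (dtors n d)| = 'C(n + d, d.+1)
        & #|MIrr (dtors n d)| =
            ((d - 1) * 'C(n + d, d.+2) + (n * n.+1) %/ 2)%N]].
Proof.
have iso := @dtors_Tam_iso n d d_gt0.
have jsd := Tam_join_semidistributive iso.
split=> //.
  split=> [[_ msd]|n2d1].
    case: (leqP n 2) => n3; [by left | right; apply/eqP; rewrite eqn_leq d_gt0 andbT].
    rewrite leqNgt; apply/negP => d2; move: msd.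
    (* The indices are 0, 1, 2, with [x = (0, ..., 0)] and [y = (0, ..., 0, 2)]; as [d >= 2], [y] is
       incomparable to [(1, ..., 1)]. *)
    pose i := Ordinal (ltnW (ltnW n3)); pose i1 := Ordinal (ltnW n3).
    pose j := Ordinal n3.
    have [t u /andP[tu ud]|t td|y yE] := @ex_os n d (fun t => if t == d.-1 then 2 else 0).
    - case: ifP => [/eqP tE|//]; case: ifP => // /eqP[].
      by apply/anti_leq; rewrite -{2}tE tu andbT -ltnS prednK.
    - by case: ifP => // _; apply: ltnW (ltnW _).
    apply: (Tam_not_meet_semidistributive iso (i := i) (i1 := i1) (j := j)
       (x := os_diag d i) (y := y)) => //.
    - by apply/os_diag_le.
    - by apply/le_os_diag => t td; rewrite yE //; case: ifP.
    rewrite negb_or; apply/andP; split; apply/negP.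
      by move/le_os_diag/(_ d.-1); rewrite yE ?eqxx prednK // => /(_ (leqnn _)).
    move/os_diag_le/(_ 0 d_gt0); rewrite yE // ltn_eqF //; by rewrite -ltnS prednK.
  split=> //; apply: (Tam_meet_semidistributive iso) => i j y /andP[i_gt0 ij] yj.
  (* If [n <= 2], the diagonal element of index [i > 0] is the top; if [d = 1], the poset is a
     chain. *)
  case: n2d1 => [n2|d1].
    apply/orP; left; apply/le_os_diag => t td.
    by apply: leq_trans i_gt0; rewrite -ltnS (leq_trans (nth_os_seq_lt y td)).
  case: (leqP (nth 0 (os_seq y) 0) i) => yi; apply/orP; [left|right].
    by apply/le_os_diag => -[//|t]; rewrite [in (_ < _)%N]d1.
  by apply/os_diag_le => -[_|t]; [apply: ltnW | rewrite [in (_ < _)%N]d1].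
have cardC := @card_os_split n d; rewrite card_os in cardC.
split.
- apply/setP => I; rewrite inE; apply/imsetP/forallP => [[T /(Tam_spine iso) T_up ->] x|].
    apply/implyP => xT; apply/forallP => y; apply/implyP => xy.
    have : @Order.le _ (os n d.+1) x y := xy.
    rewrite os_split_le => /andP[xy_init xy_last].
    (* First the last coordinate is raised by [T_up], then the others within the slice. *)
    have /T_up/(_ (imset_f _ xT))/imsetP[z zT zE] := xy_last.
    have z_init : os_init x = os_init z := congr1 fst zE.
    have z_last : os_last y = os_last z := congr1 snd zE.
    apply: (dtorsion_slice (dtors_valP T) zT z_last).
    by rewrite os_split_le -z_init -z_last xy_init leqnn.
  move=> /= I_up; have {}I_up (x y : os n d.+1) : x \in I -> x <= y -> y \in I.
    by move=> xI xy; have := implyP (I_up x) xI => /forallP/(_ y)/implyP; apply.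
  have I_tors : is_dtorsion I.
    apply/andP; split; apply/'forall_implyP => x xI.
      by apply/forallP => y; apply/implyP => /andP[_]; apply: I_up.
    (* A mixture of interlaced [x] and [z] is above [x], so an up-closed set is closed under
       mixing. *)
    apply/'forall_implyP => z _; apply/forallP => y; apply/implyP.
    case/andP=> /andP[/forallP xz _] /forallP yxz; apply: I_up xI _; rewrite leEos.
    apply/forallP => t; have := yxz t; rewrite !inE.
    by case/orP=> /eqP -> //; apply/ltnW/xz.
  exists (DTors I_tors) => //; apply/(Tam_spine iso) => x i j ij /imsetP[c cI cE].
  have xE : x = os_init c := congr1 fst cE; have iE : i = os_last c := congr1 snd cE.
  have [|e eE] := @os_split_onto n d x j.
    rewrite xE; apply: le_trans (os_init_le_diag c) _; rewrite -iE.
    by apply/le_os_diag => t td; rewrite os_diag_seq.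
  rewrite -eE; apply/imset_f/(I_up c) => //; rewrite os_split_le.
  by case: eE => -> ->; rewrite -xE lexx -iE.
- by rewrite (Tam_length iso) (Tam_card_JIrr iso).
- by rewrite (Tam_card_JIrr iso).
rewrite (Tam_card_MIrr iso) => [|i x i0]; first exact: card_MIrr_index.
by apply/os_diag_le => t _; rewrite i0.
Qed.
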